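(* There is a polynomial time algorithm which, given an undirected graph $G$ on $n$ vertices with positive edge weights and an integer $k$ with $1\le k\le n$, returns an induced subgraph $H$ of $G$ with at least $k$ vertices and density $d(H)\ge \mathrm{dal}(G,k)/2$. That is, there is a polynomial time $2$-approximation algorithm for the densest at-least-$k$-subgraph problem.
   Context: For an induced subgraph $H$ of $G$, $W(H)$ is the sum of the weights of the edges of $H$, $|H|$ is its number of vertices, and its density is $d(H)=W(H)/|H|$. $\mathrm{dal}(G,k)$ denotes the maximum density of an induced subgraph of $G$ with at least $k$ vertices. *)

(* Defs.v *)
(* "Polynomial time" refers to the random access machine with the logarithmic
   cost criterion (Cook-Reckhow; Aho-Hopcroft-Ullman), here with structured
   control flow.  It is polynomially equivalent to the Turing machine.  Since
   inputs must be finite bit strings, edge weights are positive rationals. *)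
From HB Require Import structures.
From mathcomp Require Import all_boot all_order all_algebra.
Set Implicit Arguments.
Unset Strict Implicit.
Unset Printing Implicit Defensive.
Import Order.TTheory GRing.Theory Num.Theory.

Section Machine.
Local Open Scope nat_scope.

Definition memory := nat -> nat.

Definition upd (m : memory) (a v : nat) : memory :=
  fun b => if b == a then v else m b.

(* [EGet e] is the contents of the cell whose address is the value of [e]
   (indirect addressing); [ESub] is truncated, and [EDiv] by 0 yields 0. *)
Inductive expr : Type :=
| ECst of nat
| EGet of expr
| EAdd of expr & expr
| ESub of expr & expr
| EMul of expr & expr
| EDiv of expr & expr.

(* [Store a e] stores the value of [e] in the cell whose address is the value
   of [a]; a test succeeds when its value is nonzero. *)
Inductive cmd : Type :=
| Skip
| Store of expr & expr
| Seq of cmd & cmd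
| If of expr & cmd & cmd
| While of expr & cmd.

Fixpoint eval (m : memory) (e : expr) : nat :=
  match e with
  | ECst c => c
  | EGet a => m (eval m a)
  | EAdd e1 e2 => eval m e1 + eval m e2
  | ESub e1 e2 => eval m e1 - eval m e2
  | EMul e1 e2 => eval m e1 * eval m e2
  | EDiv e1 e2 => eval m e1 %/ eval m e2
  end.

(* Length of the binary expansion of n, with [bits 0 = 1]. *)
Definition bits (n : nat) : nat := (trunc_log 2 n).+1.

(* Logarithmic cost: every subexpression is charged the bit length of its
   value, so each operation pays for its operands and its result, and each
   memory access pays for both the address and the contents. *)
Fixpoint ecost (m : memory) (e : expr) : nat :=
  bits (eval m e) +
  match e with
  | ECst _ => 0
  | EGet a => ecost m a
  | EAdd e1 e2 | ESub e1 e2 | EMul e1 e2 | EDiv e1 e2 => ecost m e1 + ecost m e2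
  end.

(* [exec c m t m'] : run from memory m, c halts after time t in memory m'. *)
Inductive exec : cmd -> memory -> nat -> memory -> Prop :=
| exec_skip m : exec Skip m 1 m
| exec_store a e m :
    exec (Store a e) m (ecost m a + ecost m e) (upd m (eval m a) (eval m e))
| exec_seq c1 c2 m t1 m1 t2 m2 :
    exec c1 m t1 m1 -> exec c2 m1 t2 m2 -> exec (Seq c1 c2) m (t1 + t2) m2
| exec_if e c1 c2 m t m' :
    exec (if eval m e != 0 then c1 else c2) m t m' ->
    exec (If e c1 c2) m (ecost m e + t) m'
| exec_while_false e c m :
    eval m e = 0 -> exec (While e c) m (ecost m e) m
| exec_while_true e c m t1 m1 t2 m2 :
    eval m e != 0 -> exec c m t1 m1 -> exec (While e c) m1 t2 m2 ->
    exec (While e c) m (ecost m e + t1 + t2) m2.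

Lemma exec_det c m t m' :
  exec c m t m' -> forall t0 m0, exec c m t0 m0 -> t0 = t /\ m0 = m'.
Proof.
elim=> {c m t m'}.
- by move=> m t0 m0 H; inversion H.
- by move=> a e m t0 m0 H; inversion H.
- move=> c1 c2 m t1 m1 t2 m2 _ IH1 _ IH2 t0 m0 H.
  inversion H as [| |? ? ? ? ? ? ? E1 E2| | |]; subst.
  by case: (IH1 _ _ E1) => ? ?; subst; case: (IH2 _ _ E2) => ? ?; subst.
- move=> e c1 c2 m t m' _ IH t0 m0 H.
  inversion H as [| | |? ? ? ? ? ? E1| |]; subst.
  by case: (IH _ _ E1) => ? ?; subst.
- move=> e c m e0 t0 m0 H.
  inversion H as [| | | | |? ? ? ? ? ? ? en0 E1 E2]; subst=> //.
  by rewrite e0 eqxx in en0.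
- move=> e c m t1 m1 t2 m2 en0 _ IH1 _ IH2 t0 m0 H.
  inversion H as [| | | |? ? ? e0|? ? ? ? ? ? ? en0' E1 E2]; subst.
    by rewrite e0 eqxx in en0.
  by case: (IH1 _ _ E1) => ? ?; subst; case: (IH2 _ _ E2) => ? ?; subst.
Qed.

(* An input word is a finite sequence of naturals stored from address 0 on,
   all other cells being 0; its length is its total number of bits. *)
Definition init_mem (s : seq nat) : memory := nth 0 s.

Definition input_size (s : seq nat) : nat := \sum_(x <- s) bits x.

End Machine.

Section Graph.
Local Open Scope ring_scope.

(* Values of [wt] outside [edge] are irrelevant. *)
Record wgraph (n : nat) := WGraph {
  edge : rel 'I_n;
  wt : 'I_n -> 'I_n -> rat;
  edge_sym : symmetric edge;
  edge_irr : irreflexive edge;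
  wt_sym : forall i j, wt i j = wt j i;
  wt_pos : forall i j, edge i j -> 0 < wt i j
}.

Variables (n : nat) (G : wgraph n).

(* An induced subgraph is given by its vertex set H; requiring i < j counts
   each edge once. *)
Definition weight (H : {set 'I_n}) : rat :=
  \sum_(i in H) \sum_(j in H | (i < j)%N && edge G i j) wt G i j.

Definition density (H : {set 'I_n}) : rat := weight H / #|H|%:R.

(* Densities are nonnegative, so the default value 0 is harmless as soon as
   some H qualifies, i.e. k <= n. *)
Definition dal (k : nat) : rat :=
  \big[Num.max/0]_(H : {set 'I_n} | (k <= #|H|)%N) density H.

(* Numerator and denominator in lowest terms, for q >= 0; 0 is (0, 1). *)
Definition encode_rat (q : rat) : seq nat := [:: `|numq q|%N; `|denq q|%N].

(* n, k, then the weighted adjacency matrix row by row, with 0 for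
   non-edges. *)
Definition encode (k : nat) : seq nat :=
  [:: n, k & flatten [seq encode_rat (if edge G i j then wt G i j else 0)
                     | i <- enum 'I_n, j <- enum 'I_n]].

(* The cells 0, ..., n-1 contain the characteristic vector of H. *)
Definition outputs (m : memory) (H : {set 'I_n}) : Prop :=
  forall i : 'I_n, m i = (i \in H) :> nat.

End Graph.

(* Main.v *)
(* Clear denominators, so that the weights are natural numbers, and let f(S) be
   the weight of the subgraph induced by S.  If H is optimal, d = d(H) and
   l <= d/2, then f(H) - l|H| >= l|H| >= l k, whereas a set S failing
   f(S) >= l max(k, |S|) has f(S) - l|S| < l (k - |S|)^+.  A set S that succeeds
   has density at least l once padded to k vertices, so it suffices to maximize
   the supermodular function f(S) - l|S| up to an error smaller than l.  This is
   done by projected subgradient ascent on its Lovasz extension over the cube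
   [0, M]^n: each edge gives its weight to the endpoint with the smaller
   coordinate, and the extension is the average of the function over the level
   sets.  At any time l is the best ratio f(S)/max(k, |S|) among all level sets
   met so far.  While l < d/2, every step decreases the squared distance to M
   times the indicator of H by a 1/(4 n^6) fraction of its maximal value, so
   4 n^6 + 1 steps suffice; they only handle integers of polynomial length. *)
Require Import Defs.
From HB Require Import structures.
From mathcomp Require Import all_boot all_order all_algebra.
From Stdlib Require Import FunctionalExtensionality.
From mathcomp Require Import zify ring.
Set Implicit Arguments.
Unset Strict Implicit.
Unset Printing Implicit Defensive.
Import Order.TTheory GRing.Theory Num.Theory.

(** * Running time *)

Lemma leq_bits L x : 0 < L -> (bits x <= L) = (x < 2 ^ L).
Proof.
move=> L_gt0; rewrite /bits; have [->|x_gt0] := posnP x.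
  by rewrite trunc_log0 L_gt0 expn_gt0.
apply/idP/idP => [le_xL|lt_xL].
  by apply: leq_trans (trunc_log_ltn x (isT : 1 < 2)) _; rewrite leq_exp2l.
by rewrite -(@ltn_exp2l 2) //; apply: leq_ltn_trans lt_xL; apply: trunc_logP.
Qed.

Lemma ltn_exp2_bits x : x < 2 ^ bits x.
Proof. by rewrite -leq_bits. Qed.

Fixpoint expr_size (e : expr) : nat :=
  match e with
  | ECst c => bits c
  | EGet a => (expr_size a).+1
  | EAdd e1 e2 | ESub e1 e2 | EMul e1 e2 | EDiv e1 e2 =>
      (expr_size e1 + expr_size e2).+1
  end.

Fixpoint expr_weight (e : expr) : nat :=
  expr_size e +
  match e with
  | ECst _ => 0
  | EGet a => expr_weight a
  | EAdd e1 e2 | ESub e1 e2 | EMul e1 e2 | EDiv e1 e2 =>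
      expr_weight e1 + expr_weight e2
  end.

(* [L * cmd_weight Z c] bounds the running time of [c] when all cells stay below
   [2 ^ L] and every loop makes fewer than [Z] iterations. *)
Fixpoint cmd_weight (Z : nat) (c : cmd) : nat :=
  match c with
  | Skip => 1
  | Store a e => expr_weight a + expr_weight e
  | Seq c1 c2 => cmd_weight Z c1 + cmd_weight Z c2
  | If e c1 c2 => expr_weight e + (cmd_weight Z c1 + cmd_weight Z c2)
  | While e c => Z * (expr_weight e + cmd_weight Z c)
  end.

Lemma cmd_weight_poly (z : {poly nat}) c :
  exists p : {poly nat}, forall n, (p.[n])%R = cmd_weight (z.[n])%R c.
Proof.
elim: c => [|a e|c1 [p1 p1E] c2 [p2 p2E]|e c1 [p1 p1E] c2 [p2 p2E]|e c [p pE]] /=.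
- by exists (1%:P)%R => n; rewrite hornerC.
- by exists ((expr_weight a + expr_weight e)%:P)%R => n; rewrite hornerC.
- by exists (p1 + p2)%R => n; rewrite hornerD p1E p2E.
- by exists ((expr_weight e)%:P + (p1 + p2))%R => n; rewrite !hornerD hornerC p1E p2E.
- by exists (z * ((expr_weight e)%:P + p))%R => n; rewrite hornerM hornerD hornerC pE.
Qed.

Section ExpressionCost.
Variables (L : nat) (m : memory).
Hypotheses (L_gt0 : 0 < L) (m_lt : forall x, m x < 2 ^ L).

Lemma eval_lt e : eval m e < 2 ^ (L * expr_size e).
Proof.
have binop_lt e1 e2 v : v <= (eval m e1).+1 * (eval m e2).+1 ->
    eval m e1 < 2 ^ (L * expr_size e1) -> eval m e2 < 2 ^ (L * expr_size e2) ->
    v < 2 ^ (L * (expr_size e1 + expr_size e2).+1).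
  move=> v_le lt1 lt2; have := leq_mul lt1 lt2; rewrite -expnD -mulnDr => le12.
  rewrite mulnS expnD; have : 2 <= 2 ^ L by rewrite (@leq_exp2l 2 1).
  by have := leq_trans v_le le12; nia.
elim: e => [c|a IH|e1 IH1 e2 IH2|e1 IH1 e2 IH2|e1 IH1 e2 IH2|e1 IH1 e2 IH2] /=.
- by apply: leq_trans (ltn_exp2_bits c) _; rewrite leq_exp2l // leq_pmull.
- by apply: leq_trans (m_lt _) _; rewrite leq_exp2l // leq_pmulr.
- by apply: binop_lt IH1 IH2; nia.
- by apply: binop_lt IH1 IH2; nia.
- by apply: binop_lt IH1 IH2; nia.
- by apply: binop_lt IH1 IH2; apply: leq_trans (leq_div _ _) _; nia.
Qed.

Lemma ecost_le e : ecost m e <= L * expr_weight e.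
Proof.
have size_gt0 e' : 0 < expr_size e' by case: e'.
have bits_le e' : bits (eval m e') <= L * expr_size e'.
  by rewrite leq_bits ?muln_gt0 ?L_gt0 ?size_gt0 // eval_lt.
have node_le e' r r' : r <= L * r' -> bits (eval m e') + r <= L * (expr_size e' + r').
  by move=> le_r; rewrite mulnDr leq_add.
elim: e => [c|a IH|e1 IH1 e2 IH2|e1 IH1 e2 IH2|e1 IH1 e2 IH2|e1 IH1 e2 IH2].
- exact: (node_le (ECst c) 0 0).
- exact: (node_le (EGet a)).
- by apply: (node_le (EAdd e1 e2)); rewrite mulnDr leq_add.
- by apply: (node_le (ESub e1 e2)); rewrite mulnDr leq_add.
- by apply: (node_le (EMul e1 e2)); rewrite mulnDr leq_add.
- by apply: (node_le (EDiv e1 e2)); rewrite mulnDr leq_add.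
Qed.

Lemma exec_store_le a e x y : eval m a = x -> eval m e = y ->
  exists2 t, exec (Store a e) m t (upd m x y) &
    t <= L * (expr_weight a + expr_weight e).
Proof.
move=> <- <-; exists (ecost m a + ecost m e); first exact: exec_store.
by rewrite mulnDr leq_add ?ecost_le.
Qed.

End ExpressionCost.

Lemma exec_while_le e c (Inv : nat -> memory -> Prop) te tc :
  (forall r m, Inv r m -> eval m e = r /\ ecost m e <= te) ->
  (forall r m, Inv r.+1 m -> exists t m', [/\ exec c m t m', t <= tc & Inv r m']) ->
  forall r m, Inv r m ->
  exists t m', [/\ exec (While e c) m t m', t <= r.+1 * (te + tc) & Inv 0 m'].
Proof.
move=> cond body; elim=> [|r IH] m Im; have [me e_le] := cond _ _ Im.
  exists (ecost m e), m; split=> //; first exact: exec_while_false.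
  by rewrite mul1n (leq_trans e_le) ?leq_addr.
have [t1 [m1 [run1 time1 /IH[t2 [m2 [run2 time2 I2]]]]]] := body _ _ Im.
exists (ecost m e + t1 + t2), m2; split=> //.
  by apply: exec_while_true run1 run2; rewrite me.
by rewrite mulSn !leq_add.
Qed.

(** * Programs over array variables *)

Section Language.
Variables (V : finType) (input : V).

Inductive pexpr : Type :=
| Const of nat
| Cell of V & pexpr
| Add of pexpr & pexpr
| Sub of pexpr & pexpr
| Mul of pexpr & pexpr
| Div of pexpr & pexpr.

(* [For j bound body] runs [body] for [j = 0, ..., bound - 1], where scalars such
   as [j] are arrays of which only entry 0 is used. *)
Inductive prog : Type :=
| Assign of V & pexpr & pexpr
| Then of prog & prog
| When of pexpr & prog
| For of V & pexpr & prog.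

Definition fold_loop (acc j : V) (bound e0 e : pexpr) : prog :=
  Then (Assign acc (Const 0) e0) (For j bound (Assign acc (Const 0) e)).

Definition sum_loop (acc j : V) (bound e : pexpr) : prog :=
  fold_loop acc j bound (Const 0) (Add (Cell acc (Const 0)) e).

Definition map_loop (v j : V) (bound e : pexpr) : prog :=
  For j bound (Assign v (Cell j (Const 0)) e).

Definition increment (v : V) : prog :=
  Assign v (Const 0) (Add (Cell v (Const 0)) (Const 1)).

Fixpoint writes (p : prog) : seq V :=
  match p with
  | Assign v _ _ => [:: v]
  | Then p1 p2 => writes p1 ++ writes p2
  | When _ p => writes p
  | For j _ p => j :: writes p
  end.

Definition code (v : V) : nat := index v (enum V).

Definition decode (c : nat) : V := nth input (enum V) c.

Definition address (v : V) (e : expr) : expr :=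
  if v == input then e
  else EAdd (EGet (ECst 0)) (EAdd (EMul (ECst #|V|) e) (ECst (code v))).

Fixpoint compile_expr (e : pexpr) : expr :=
  match e with
  | Const c => ECst c
  | Cell v e => EGet (address v (compile_expr e))
  | Add e1 e2 => EAdd (compile_expr e1) (compile_expr e2)
  | Sub e1 e2 => ESub (compile_expr e1) (compile_expr e2)
  | Mul e1 e2 => EMul (compile_expr e1) (compile_expr e2)
  | Div e1 e2 => EDiv (compile_expr e1) (compile_expr e2)
  end.

Definition compile_assign (v : V) (i e : pexpr) : cmd :=
  Store (address v (compile_expr i)) (compile_expr e).

Fixpoint compile (p : prog) : cmd :=
  match p with
  | Assign v i e => compile_assign v i e
  | Then p1 p2 => Seq (compile p1) (compile p2)
  | When e p => If (compile_expr e) (compile p) Skip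
  | For j bound p =>
      Seq (compile_assign j (Const 0) (Const 0))
          (While (compile_expr (Sub bound (Cell j (Const 0))))
                 (Seq (compile p)
                      (compile_assign j (Const 0) (Add (Cell j (Const 0)) (Const 1)))))
  end.

Definition state : Type := V -> nat -> nat.

Definition state_upd (s : state) (v : V) (i x : nat) : state :=
  fun v' i' => if (v' == v) && (i' == i) then x else s v' i'.

Definition frame (l : seq V) (s s' : state) : Prop :=
  forall v, v \notin l -> s' v = s v.

Section Layout.
Variable b : nat.
Hypothesis b_gt0 : 0 < b.

(* Cell 0 holds [b], the cells between 0 and [b] form the array [input], and the
   other arrays are interleaved from [b] on, the slots of [input] being empty. *)
Definition location (v : V) (i : nat) : nat :=
  if v == input then i else b + (#|V| * i + code v).

Definition writable (v : V) (i : nat) : bool := (v == input) ==> (0 < i < b).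

Definition mem_of (s : state) : memory :=
  fun x => if x == 0 then b else if x < b then s input x else
    let v := decode ((x - b) %% #|V|) in
    if v == input then 0 else s v ((x - b) %/ #|V|).

Definition lookup (s : state) (v : V) (i : nat) : nat :=
  if v == input then mem_of s i else s v i.

Fixpoint peval (s : state) (e : pexpr) : nat :=
  match e with
  | Const c => c
  | Cell v e => lookup s v (peval s e)
  | Add e1 e2 => peval s e1 + peval s e2
  | Sub e1 e2 => peval s e1 - peval s e2
  | Mul e1 e2 => peval s e1 * peval s e2
  | Div e1 e2 => peval s e1 %/ peval s e2
  end.

Lemma mem_of_input s i : 0 < i < b -> mem_of s i = s input i.
Proof. by case/andP=> i_gt0 ib; rewrite /mem_of ib gtn_eqF. Qed.

Lemma code_lt v : code v < #|V|.
Proof. by rewrite cardE index_mem mem_enum. Qed.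

Lemma mem_of_location s v i : mem_of s (location v i) = lookup s v i.
Proof.
rewrite /location /lookup; case: ifP => // v_ninput.
rewrite /mem_of addn_eq0 -[b == 0]negbK -lt0n b_gt0 ltnNge leq_addr /= addKn mulnC.
have V_gt0 : 0 < #|V| by apply: leq_ltn_trans (code_lt v).
rewrite modnMDl divnMDl // modn_small ?divn_small ?code_lt // addn0.
by rewrite /decode nth_index ?mem_enum // v_ninput.
Qed.

Lemma eval_address s v e : eval (mem_of s) (address v e) = location v (eval (mem_of s) e).
Proof. by rewrite /address /location; case: ifP. Qed.

Lemma eval_compile s e : eval (mem_of s) (compile_expr e) = peval s e.
Proof.
elim: e => //= [v e <-|? -> ? ->|? -> ? ->|? -> ? ->|? -> ? ->] //.
by rewrite eval_address mem_of_location.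
Qed.

Lemma upd_mem_of s v i x : writable v i ->
  upd (mem_of s) (location v i) x = mem_of (state_upd s v i x).
Proof.
rewrite /writable => v_wr; apply: functional_extensionality => y; rewrite /upd.
have [->|y_neq] := eqVneq y (location v i).
  rewrite mem_of_location; have [ev|v_ninput] := eqVneq v input.
    by rewrite ev /lookup eqxx mem_of_input /state_upd ?eqxx //; rewrite ev eqxx in v_wr.
  by rewrite /lookup (negPf v_ninput) /state_upd !eqxx.
rewrite /mem_of /state_upd; case: ifP => // y_neq0.
have [yb|b_le] := ltnP y b.
  case: eqP => //= ev; case: eqP => // ei.
  by rewrite /location -ev eqxx ei eqxx in y_neq.
case: ifP => // dec_ninput; case: andP => // -[/eqP ev /eqP ei].
case/eqP: y_neq; rewrite /location -ev dec_ninput /code /decode index_uniq ?enum_uniq //.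
  by rewrite -ei mulnC -divn_eq subnKC.
by rewrite -cardE ltn_pmod // (leq_ltn_trans _ (code_lt v)).
Qed.

End Layout.

Lemma frame_trans l s1 s2 s3 : frame l s1 s2 -> frame l s2 s3 -> frame l s1 s3.
Proof. by move=> f12 f23 v v_nl; rewrite f23 ?f12. Qed.

Lemma frame_sub l l' s s' : {subset l <= l'} -> frame l s s' -> frame l' s s'.
Proof. by move=> sub_l f v v_nl'; apply: f; apply: contra v_nl' => /sub_l. Qed.

Lemma frame_upd s v i x : frame [:: v] s (state_upd s v i x).
Proof.
move=> v'; rewrite inE => v'_neq; apply: functional_extensionality => i'.
by rewrite /state_upd (negPf v'_neq).
Qed.

Lemma frame_disjoint (l l' : seq V) s s' :
  frame l s s' -> ~~ has (mem l') l -> {in l', s' =1 s}.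
Proof. by move=> f /hasPn disj v v_l'; apply: f; apply/negP => /disj /negP[]. Qed.

Section Triples.
Variables (b L Z : nat).

Definition bounded (s : state) : Prop := forall v i, s v i < 2 ^ L.

Definition triple (p : prog) (s : state) (Q : state -> Prop) : Prop :=
  bounded s -> exists t s',
    [/\ exec (compile p) (mem_of b s) t (mem_of b s'),
        t <= L * cmd_weight Z (compile p), bounded s', frame (writes p) s s' & Q s'].

Hypotheses (b_gt0 : 0 < b) (b_lt : b < 2 ^ L).

Lemma exponent_gt0 : 0 < L.
Proof. by case: L b_lt => //; case: b b_gt0. Qed.

Lemma mem_of_lt s : bounded s -> forall x, mem_of b s x < 2 ^ L.
Proof. by move=> s_lt x; rewrite /mem_of; do 3?case: ifP => // _; rewrite expn_gt0. Qed.

Lemma ecost_compile_le s e : bounded s ->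
  ecost (mem_of b s) (compile_expr e) <= L * expr_weight (compile_expr e).
Proof. by move=> s_lt; apply: ecost_le (mem_of_lt s_lt) _; apply: exponent_gt0. Qed.

Lemma triple_conseq p s (Q Q' : state -> Prop) :
  triple p s Q -> (forall s', frame (writes p) s s' -> Q s' -> Q' s') -> triple p s Q'.
Proof.
by move=> pQ QQ' /pQ[t [s' [? ? ? f Qs']]]; exists t, s'; split=> //; apply: QQ'.
Qed.

Lemma triple_bounded p s (Q : state -> Prop) :
  (bounded s -> triple p s Q) -> triple p s Q.
Proof. by move=> spec s_small; apply: spec. Qed.

Lemma triple_assign v i e s c x :
  peval b s i = c -> peval b s e = x -> writable b v c -> x < 2 ^ L ->
  triple (Assign v i e) s (fun s' => s' v =1 [eta s v with c |-> x]).
Proof.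
move=> ei ee v_wr x_lt s_small; have m_lt := mem_of_lt s_small.
have [||t run t_le] := @exec_store_le L (mem_of b s) exponent_gt0 m_lt
    (address v (compile_expr i)) (compile_expr e) (location b v c) x.
- by rewrite eval_address eval_compile // ei.
- by rewrite eval_compile.
rewrite upd_mem_of // in run.
exists t, (state_upd s v c x); split=> //; last 2 first.
- exact: frame_upd.
- by move=> i'; rewrite /state_upd /= eqxx.
- by move=> v' i'; rewrite /state_upd; case: ifP.
Qed.

Lemma triple_set v e s x :
  v != input -> peval b s e = x -> x < 2 ^ L ->
  triple (Assign v (Const 0) e) s (fun s' => s' v 0 = x).
Proof.
move=> v_ninput ee x_lt.
have v_wr : writable b v 0 by rewrite /writable (negPf v_ninput).
by apply: triple_conseq (triple_assign (i := Const 0) (erefl 0) ee v_wr x_lt) _ => s' _ ->.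
Qed.

Lemma triple_then p1 p2 s (Q1 Q : state -> Prop) :
  triple p1 s Q1 ->
  (forall s1, frame (writes p1) s s1 -> Q1 s1 -> triple p2 s1 Q) ->
  triple (Then p1 p2) s Q.
Proof.
move=> spec1 spec2 /spec1[t1 [s1 [run1 time1 small1 f1 /(spec2 _ f1)/(_ small1)]]].
case=> t2 [s2 [run2 time2 small2 f2 Qs2]]; exists (t1 + t2), s2; split=> //.
- exact: exec_seq run1 run2.
- by rewrite /= mulnDr leq_add.
- apply: frame_trans (_ : frame _ s s1) (_ : frame _ s1 s2).
    by apply: frame_sub f1 => v /= v1; rewrite mem_cat v1.
  by apply: frame_sub f2 => v /= v2; rewrite mem_cat v2 orbT.
Qed.

Lemma triple_when e p s (Q : state -> Prop) :
  (peval b s e != 0 -> triple p s Q) -> (peval b s e = 0 -> Q s) ->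
  triple (When e p) s Q.
Proof.
move=> run skip s_lt; have e_le := ecost_compile_le e s_lt.
pose te := ecost (mem_of b s) (compile_expr e).
have [e0|e_neq0] := eqVneq (peval b s e) 0.
  exists (te + 1), s; split=> //; last exact: skip.
    by apply: exec_if; rewrite eval_compile // e0; apply: exec_skip.
  by rewrite /= !mulnDr leq_add // muln1 (leq_trans exponent_gt0) ?leq_addl.
have [t [s' [ex t_le s'_lt f Qs']]] := run e_neq0 s_lt.
exists (te + t), s'; split=> //; first by apply: exec_if; rewrite eval_compile // e_neq0.
by rewrite /= !mulnDr leq_add // (leq_trans t_le) ?leq_addr.
Qed.

Section ForLoop.
Variables (Inv : nat -> state -> Prop) (N : nat).
Variables (j : V) (bound : pexpr) (body : prog) (s : state).
Hypotheses (j_ninput : j != input) (j_nbody : j \notin writes body).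
Hypotheses (NZ : N < Z) (N_lt : N < 2 ^ L).
Hypothesis bound_eq :
  forall s', frame (j :: writes body) s s' -> peval b s' bound = N.
Hypothesis init : forall s', frame [:: j] s s' -> Inv 0 s'.
Hypothesis step : forall i s1, i < N ->
  frame (j :: writes body) s s1 -> s1 j 0 = i -> Inv i s1 ->
  triple body s1 (fun s2 => forall s3, frame [:: j] s2 s3 -> Inv i.+1 s3).

Let before i s' := [/\ frame (j :: writes body) s s', s' j 0 = i & Inv i s'].

Let lookup_counter s' : lookup b s' j 0 = s' j 0.
Proof. by rewrite /lookup (negPf j_ninput). Qed.

Let triple_iteration i s1 : i < N -> before i s1 ->
  triple (Then body (increment j)) s1 (before i.+1).
Proof.
move=> iN [f1 j1 I1]; apply: triple_then (step iN f1 j1 I1) _ => s2 f2 I2.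
apply: triple_conseq (triple_set (x := i.+1) j_ninput _ _) _ => [||s3 f3 j3].
- by rewrite /= lookup_counter f2 // j1 addn1.
- exact: leq_ltn_trans N_lt.
split=> //; last exact: I2.
apply: frame_trans f1 (frame_trans (s2 := s2) _ _).
  by apply: frame_sub f2 => v; rewrite inE => ->; rewrite orbT.
by apply: frame_sub f3 => v; rewrite !inE => ->.
Qed.

Lemma triple_for : triple (For j bound body) s (Inv N).
Proof.
move=> s_small; pose cond := compile_expr (Sub bound (Cell j (Const 0))).
pose left r m := exists i s', [/\ i + r = N, m = mem_of b s', bounded s' & before i s'].
have [] // := triple_set (v := j) (e := Const 0) (s := s) (x := 0) _ _ _ s_small.
  by rewrite expn_gt0.
move=> t0 [s0 [run0 time0 small0 f0 j0]].
have left0 : left N (mem_of b s0).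
  exists 0, s0; split=> //; split=> //; last exact: init.
  by apply: frame_sub f0 => v; rewrite !inE => ->.
have [||t [m [run time [i [s' [iN mE s'_small [f' _ Is']]]]]]] := exec_while_le
    (e := cond) (te := L * expr_weight cond) (c := compile (Then body (increment j)))
    (tc := L * cmd_weight Z (compile (Then body (increment j)))) _ _ left0.
- move=> r m [i [s1 [irN -> s1_small [f1 j1 _]]]]; split; last exact: ecost_compile_le.
  by rewrite eval_compile //= bound_eq // lookup_counter j1 -irN addKn.
- move=> r m [i [s1 [irN -> s1_small before1]]]; have iN : i < N by lia.
  have [t [s2 [run2 time2 small2 _ before2]]] := triple_iteration iN before1 s1_small.
  exists t, (mem_of b s2); split=> //; exists i.+1, s2; split=> //; lia.
rewrite addn0 in iN; rewrite mE in run; rewrite iN in Is'.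
exists (t0 + t), s'; split=> //; first exact: exec_seq run0 run.
rewrite -mulnDr mulnCA in time; rewrite [leqRHS]mulnDr leq_add // (leq_trans time) //.
by rewrite leq_mul2l leq_mul2r NZ !orbT.
Qed.

End ForLoop.

Lemma triple_fold (g : nat -> nat) N acc j bound e0 e s :
  acc != input -> j != input -> acc != j -> N < Z -> N < 2 ^ L ->
  (forall i, i <= N -> g i < 2 ^ L) ->
  peval b s e0 = g 0 ->
  (forall s', frame [:: acc; j] s s' -> peval b s' bound = N) ->
  (forall s' i, i < N -> frame [:: acc; j] s s' -> s' j 0 = i -> s' acc 0 = g i ->
     peval b s' e = g i.+1) ->
  triple (fold_loop acc j bound e0 e) s (fun s' => s' acc 0 = g N).
Proof.
move=> acc_ninput j_ninput acc_j NZ N_lt g_lt e0E boundE eE.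
apply: triple_then (triple_set acc_ninput e0E (g_lt _ (leq0n _))) _ => s1 f1 acc1.
have f1' s' : frame [:: j; acc] s1 s' -> frame [:: acc; j] s s'.
  move=> f'; apply: frame_trans (_ : frame _ s s1) (_ : frame _ s1 s').
    by apply: frame_sub f1 => v; rewrite !inE => ->.
  by apply: frame_sub f' => v; rewrite !inE orbC.
apply: (triple_for (Inv := fun i s' => s' acc 0 = g i)) => //.
- by rewrite inE eq_sym.
- by move=> s' /f1'/boundE.
- by move=> s' f'; rewrite f' // inE.
move=> i s2 iN /f1' f2 j2 acc2.
apply: triple_conseq (triple_set acc_ninput (eE _ _ iN f2 j2 acc2) (g_lt _ iN)) _.
by move=> s3 _ acc3 s4 f4; rewrite f4 // inE.
Qed.

Lemma triple_sum (F : nat -> nat) N acc j bound e s :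
  acc != input -> j != input -> acc != j -> N < Z -> N < 2 ^ L ->
  \sum_(i < N) F i < 2 ^ L ->
  (forall s', frame [:: acc; j] s s' -> peval b s' bound = N) ->
  (forall s' i, i < N -> frame [:: acc; j] s s' -> s' j 0 = i -> peval b s' e = F i) ->
  triple (sum_loop acc j bound e) s (fun s' => s' acc 0 = \sum_(i < N) F i).
Proof.
move=> acc_ninput j_ninput acc_j NZ N_lt sum_lt boundE eE.
apply: (triple_fold (g := fun r => \sum_(i < r) F i)) => //.
- move=> i iN; apply: leq_ltn_trans sum_lt; rewrite (big_ord_widen N F iN) big_mkcond.
  by apply: leq_sum => p _; case: ifP.
- by rewrite big_ord0.
- move=> s' i iN f j_eq acc_eq.
  by rewrite /= (eE _ i) // /lookup (negPf acc_ninput) acc_eq big_ord_recr.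
Qed.

Lemma triple_map (F : nat -> nat) N v j bound e s :
  v != input -> j != input -> v != j -> N < Z -> N < 2 ^ L ->
  (forall i, i < N -> F i < 2 ^ L) ->
  (forall s', frame [:: v; j] s s' -> peval b s' bound = N) ->
  (forall s' i, i < N -> frame [:: v; j] s s' -> s' j 0 = i -> s' v i = s v i ->
     peval b s' e = F i) ->
  triple (map_loop v j bound e) s (fun s' => forall i, i < N -> s' v i = F i).
Proof.
move=> v_ninput j_ninput v_j NZ N_lt F_lt boundE eE.
have swap s' : frame [:: j; v] s s' -> frame [:: v; j] s s'.
  by move=> f; apply: frame_sub f => v'; rewrite !inE orbC.
pose Inv i (s' : state) := forall i', s' v i' = if i' < i then F i' else s v i'.
apply: triple_conseq (_ : triple _ _ (Inv N)) _; last first.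
  by move=> s' _ Is' i iN; rewrite Is' iN.
apply: triple_for => //.
- by rewrite inE eq_sym.
- by move=> s' /swap/boundE.
- by move=> s' f' i; rewrite f' // inE.
move=> i s1 iN /swap f1 j1 I1; have e1 : peval b s1 e = F i.
  by apply: eE => //; rewrite I1 ltnn.
have j1' : peval b s1 (Cell j (Const 0)) = i by rewrite /= /lookup (negPf j_ninput).
have v_wr : writable b v i by rewrite /writable (negPf v_ninput).
apply: triple_conseq (triple_assign j1' e1 v_wr (F_lt _ iN)) _ => s2 _ v2 s3 f3 i'.
rewrite f3 ?inE // v2 /= ltnS leq_eqVlt I1.
by case: eqP => [->|].
Qed.

End Triples.

End Language.

Arguments lookup [V] input b s !v i /.
Arguments triple_assign [V input b L Z] b_gt0 b_lt [v i e s c x].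
Arguments triple_set [V input b L Z] b_gt0 b_lt [v e s x].

(** * Subgradient ascent *)

Lemma big_setT (R : Type) (idx : R) (op : R -> R -> R) (I : finType) (F : I -> R) :
  \big[op/idx]_(i in setT) F i = \big[op/idx]_i F i.
Proof. by apply: eq_bigl => i; rewrite inE. Qed.

Lemma leq_sum_subset (I : finType) (F : I -> nat) (A B : {set I}) :
  A \subset B -> \sum_(i in A) F i <= \sum_(i in B) F i.
Proof.
move=> sAB; rewrite big_mkcond [leqRHS]big_mkcond; apply: leq_sum => i _.
by case: ifP => // /(subsetP sAB) ->.
Qed.

Lemma sum_ltn M z : z <= M -> \sum_(h < M) ((h < z) : nat) = z.
Proof.
move=> zM; rewrite -[RHS]mul1n -iter_addn_0 -big_const_ord.
by rewrite (big_ord_widen M (fun=> 1) zM) [RHS]big_mkcond.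
Qed.

Section Ascent.
Variables (V : finType) (w : V -> V -> nat).
Hypothesis w_sym : forall u v, w u v = w v u.

(* Ordered pairs: each edge inside [S] is counted twice. *)
Definition pair_weight (S : {set V}) : nat := \sum_(u in S) \sum_(v in S) w u v.

Definition level (x : V -> nat) (u : V) : {set V} := [set v | x u <= x v].

(* Each edge gives its weight to its endpoint with the smaller [x], and half of it
   to both endpoints in case of a tie; everything is doubled. *)
Definition load (x : V -> nat) (v : V) : nat :=
  \sum_u w v u * ((x v <= x u) + (x v < x u)).

Lemma pair_weight0 : pair_weight set0 = 0.
Proof. by rewrite /pair_weight big_set0. Qed.

Lemma pair_weightT : pair_weight setT = \sum_u \sum_v w u v.
Proof.
by rewrite /pair_weight big_setT; apply: eq_bigr => u _; rewrite big_setT.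
Qed.

Lemma pair_weight_subset (S S' : {set V}) :
  S \subset S' -> pair_weight S <= pair_weight S'.
Proof.
move=> sSS'; apply: leq_trans (leq_sum_subset _ sSS').
by apply: leq_sum => u _; apply: leq_sum_subset.
Qed.

Lemma load_le x v : load x v <= 2 * pair_weight setT.
Proof.
rewrite pair_weightT (bigD1 v) //= mulnDr; apply: leq_trans (leq_addr _ _).
by rewrite big_distrr; apply: leq_sum => u _ /=; lia.
Qed.

Lemma sum_smaller_endpoint (x c : V -> nat) (S : {set V}) :
  \sum_(v in S) c v * (\sum_(u in S) w v u * ((x v <= x u) + (x v < x u))) =
  \sum_(v in S) \sum_(u in S) w v u * (if x v <= x u then c v else c u).
Proof.
transitivity (\sum_(v in S) \sum_(u in S) (w v u * (c v * (x v <= x u))) +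
              \sum_(v in S) \sum_(u in S) (w v u * (c v * (x v < x u)))).
  rewrite -big_split /=; apply: eq_bigr => v _; rewrite big_distrr -big_split /=.
  by apply: eq_bigr => u _; nia.
rewrite [X in _ + X]exchange_big /= -big_split; apply: eq_bigr => v _.
rewrite -big_split; apply: eq_bigr => u _ /=; rewrite (w_sym u v).
by case: leqP => _ /=; nia.
Qed.

Lemma pair_weight_le_load x (S : {set V}) : pair_weight S <= \sum_(v in S) load x v.
Proof.
have -> : pair_weight S =
    \sum_(v in S) 1 * (\sum_(u in S) w v u * ((x v <= x u) + (x v < x u))).
  rewrite (sum_smaller_endpoint x (fun=> 1)); apply: eq_bigr => v _.
  by apply: eq_bigr => u _; rewrite if_same muln1.
apply: leq_sum => v _; rewrite mul1n /load -[leqRHS]big_setT.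
exact/leq_sum_subset/subsetT.
Qed.

Section Levels.
Variables (M : nat) (x : V -> nat).
Hypothesis x_le : forall v, x v <= M.

Lemma sum_mul_load : \sum_v x v * load x v = \sum_v \sum_u w v u * minn (x v) (x u).
Proof.
have := sum_smaller_endpoint x x setT; rewrite !big_setT => sum_eq.
transitivity (\sum_v x v * \sum_(u in setT) w v u * ((x v <= x u) + (x v < x u))).
  by apply: eq_bigr => v _; rewrite big_setT.
rewrite sum_eq; apply: eq_bigr => v _; rewrite big_setT; apply: eq_bigr => u _.
by case: leqP.
Qed.

(* The Lovasz extension as the average over the level sets. *)
Lemma sum_mul_load_levels :
  \sum_v x v * load x v = \sum_(h < M) pair_weight [set v | h < x v].
Proof.
rewrite sum_mul_load.
transitivity (\sum_v \sum_u \sum_(h < M) w v u * ((h < x v) * (h < x u))).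
  apply: eq_bigr => v _; apply: eq_bigr => u _; rewrite -big_distrr /=; congr (_ * _).
  rewrite -[LHS](@sum_ltn M) ?geq_min ?x_le //; apply: eq_bigr => h _.
  by rewrite leq_min mulnb.
under eq_bigr do rewrite exchange_big; rewrite exchange_big.
apply: eq_bigr => h _; rewrite /pair_weight [RHS]big_mkcond; apply: eq_bigr => v _.
rewrite inE; case: ifP => h_lt; last by rewrite big1 // => u _; rewrite muln0.
rewrite [RHS]big_mkcond; apply: eq_bigr => u _; rewrite inE.
by case: ifP; rewrite ?muln1 ?muln0.
Qed.

Lemma sum_card_levels : \sum_v x v = \sum_(h < M) #|[set v | h < x v]|.
Proof.
transitivity (\sum_v \sum_(h < M) ((h < x v) : nat)).
  by apply: eq_bigr => v _; rewrite sum_ltn.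
rewrite exchange_big; apply: eq_bigr => h _.
by rewrite -sum1dep_card [RHS]big_mkcond.
Qed.

End Levels.

Lemma superlevel_level (x : V -> nat) h v0 : h < x v0 ->
  exists u, [set v | h < x v] = level x u.
Proof.
move=> hv0; have [u hu umin] := @arg_minnP _ v0 (fun v => h < x v) x hv0.
exists u; apply/setP => v; rewrite !inE; apply/idP/idP => [/umin//|].
exact: leq_trans.
Qed.

Variable k : nat.

Definition padded_card (S : {set V}) : nat := maxn k #|S|.

Definition ratio_le (S S' : {set V}) : Prop :=
  pair_weight S * padded_card S' <= pair_weight S' * padded_card S.

Definition doubles (H S : {set V}) : bool :=
  2 * pair_weight S * #|H| < padded_card S * pair_weight H.

Definition half_optimal (S : {set V}) : Prop :=
  forall H : {set V}, k <= #|H| -> ~~ doubles H S.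

Lemma padded_card_le S : k <= #|V| -> padded_card S <= #|V|.
Proof. by rewrite geq_max max_card andbT. Qed.

Lemma ratio_le_refl S : ratio_le S S.
Proof. exact: leqnn. Qed.

Local Notation W := (pair_weight setT).
Local Notation n := #|V|.

Definition cube_side : nat := 4 * n ^ 4 * W.

Local Notation M := cube_side.

Definition step (S : {set V}) (x : V -> nat) (v : V) : nat :=
  minn (x v + padded_card S * load x v - pair_weight S) M.

Definition sqdist (H : {set V}) (x : V -> nat) : int :=
  (\sum_v ((x v)%:Z - (M * (v \in H))%:Z) ^+ 2)%R.

(* A supergradient, up to a positive factor, of the extension of
   [f T - (f S / padded_card S) * #|T|] at [x], where [f] is half of [pair_weight]. *)
Definition gradient (S : {set V}) (x : V -> nat) (v : V) : int :=
  ((padded_card S * load x v)%:Z - (pair_weight S)%:Z)%R.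

Lemma sum_gradient (F : V -> nat) S x (H : {set V}) :
  (\sum_(v in H) gradient S x v * (F v)%:Z =
   (padded_card S * \sum_(v in H) F v * load x v)%:Z -
   (pair_weight S * \sum_(v in H) F v)%:Z)%R.
Proof.
rewrite !big_distrr !(big_morph Posz PoszD (erefl _)) -sumrN -big_split /=.
by apply: eq_bigr => v _; rewrite /gradient !PoszM; ring.
Qed.

Lemma gradient_set_ge S x (H : {set V}) : k <= #|H| -> doubles H S ->
  ((pair_weight S * k)%:Z <= \sum_(v in H) gradient S x v)%R.
Proof.
rewrite /doubles => kH dbl.
have -> : (\sum_(v in H) gradient S x v =
    (padded_card S * \sum_(v in H) load x v)%:Z - (pair_weight S * #|H|)%:Z)%R.
  transitivity (\sum_(v in H) gradient S x v * 1%:Z)%R.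
    by apply: eq_bigr => v _; rewrite [RHS]mulr1.
  rewrite (sum_gradient (fun=> 1)) sum1_card; congr (Posz (_ * _) - _)%R.
  by apply: eq_bigr => v _; rewrite mul1n.
have le_load := leq_mul (leqnn (padded_card S)) (pair_weight_le_load x H).
have le_k := leq_mul (leqnn (pair_weight S)) kH.
by move: dbl; rewrite -mulnA; lia.
Qed.

Lemma sqdist_step_le S x (H : {set V}) : (forall v, x v <= M) ->
  (sqdist H (step S x) <=
   \sum_v ((x v)%:Z + gradient S x v - (M * (v \in H))%:Z) ^+ 2)%R.
Proof.
move=> x_le; apply: ler_sum => v _; rewrite /step /gradient; have := x_le v.
case: (v \in H); rewrite ?muln1 ?muln0;
  by move: (padded_card S * load x v) (x v) => y z; nia.
Qed.

Lemma sqdist_expand S x (H : {set V}) :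
  (\sum_v ((x v)%:Z + gradient S x v - (M * (v \in H))%:Z) ^+ 2 =
   sqdist H x + 2%:R * (\sum_v gradient S x v * (x v)%:Z)
   - 2%:R * (M%:Z * \sum_(v in H) gradient S x v) + \sum_v gradient S x v ^+ 2)%R.
Proof.
rewrite /sqdist [X in (_ - 2%:R * (_ * X))%R]big_mkcond /=.
rewrite !big_distrr -!big_split -sumrN -!big_split /=.
by apply: eq_bigr => v _; case: (v \in H); rewrite ?muln1 ?muln0; ring.
Qed.

Definition rounds : nat := (4 * n ^ 6).+1.

(* As long as [H] doubles the best set [S] found in the first [t] rounds, the
   squared distance from the point [x] to [M] times the indicator of [H] has
   decreased by [M * W / n] in each of them. *)
Definition ascending (t : nat) (x : V -> nat) (S : {set V}) : Prop :=
  [/\ forall v, x v <= M, ratio_le setT S &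
    forall H : {set V}, k <= #|H| -> doubles H S ->
    (n%:Z * sqdist H x + (t * (M * W))%:Z <= (n * n * M ^ 2)%:Z)%R].

Lemma ascending_init x : (forall v, x v = M) -> ascending 0 x setT.
Proof.
move=> xE; split=> [v||H _ _]; [by rewrite xE | exact: ratio_le_refl|].
rewrite mul0n addr0 -mulnA PoszM ler_wpM2l //.
have -> : ((n * M ^ 2)%:Z = \sum_(v : V) (M ^ 2)%:Z)%R.
  by rewrite sumr_const PoszM; ring.
apply: ler_sum => v _; rewrite xE.
by case: (v \in H); rewrite ?muln1 ?muln0 ?subrr ?subr0.
Qed.

Hypothesis k_gt0 : 0 < k.

Lemma padded_card_gt0 S : 0 < padded_card S.
Proof. by rewrite leq_max k_gt0. Qed.

Lemma ratio_le_trans S1 S2 S3 : ratio_le S1 S2 -> ratio_le S2 S3 -> ratio_le S1 S3.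
Proof.
rewrite /ratio_le => le12 le23; rewrite -(leq_pmul2l (padded_card_gt0 S2)); nia.
Qed.

Lemma doubles_ratio_le H S S' : ratio_le S S' -> doubles H S' -> doubles H S.
Proof.
rewrite /doubles /ratio_le => le_SS' dbl.
rewrite -(ltn_pmul2l (padded_card_gt0 S')); have := padded_card_gt0 S; nia.
Qed.

Section Step.
Variables (S : {set V}) (x : V -> nat).
Hypothesis x_le : forall v, x v <= M.

Lemma gradient_point_le : (forall u, ratio_le (level x u) S) ->
  (\sum_v gradient S x v * (x v)%:Z <= (M * (pair_weight S * k.-1))%:Z)%R.
Proof.
move=> levels_le; rewrite -big_setT sum_gradient !big_setT.
suff : padded_card S * (\sum_v x v * load x v) <=
    pair_weight S * (\sum_v x v) + M * (pair_weight S * k.-1) by lia.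
rewrite (sum_mul_load_levels x_le) (sum_card_levels x_le) !big_distrr /=.
rewrite -[X in _ + X * _](card_ord M) -sum_nat_const -big_split /=; apply: leq_sum => h _.
have [->|[v0]] := set_0Vmem [set v | h < x v]; first by rewrite pair_weight0 muln0.
rewrite inE => h_lt; have [u levE] := superlevel_level h_lt.
have : 0 < #|level x u| by rewrite -levE; apply/card_gt0P; exists v0; rewrite inE.
rewrite levE mulnC => card_gt0; apply: leq_trans (levels_le u) _.
rewrite -mulnDr leq_mul2l /padded_card; lia.
Qed.

Hypothesis k_le : k <= n.
Hypothesis S_ge : ratio_le setT S.

Lemma pair_weight_ge : W <= pair_weight S * n.
Proof.
move: S_ge; rewrite /ratio_le /(padded_card setT) cardsT (maxn_idPr k_le).
by apply: leq_trans; rewrite leq_pmulr ?padded_card_gt0.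
Qed.

Lemma gradient_sqr_le :
  (\sum_v gradient S x v ^+ 2 <= (M * pair_weight S)%:Z)%R.
Proof.
have n_gt0 : 0 < n by apply: leq_trans k_le.
suff sum_le : (\sum_v gradient S x v ^+ 2 <= (n * (2 * n * W) ^ 2)%:Z)%R.
  apply: le_trans sum_le _; rewrite lez_nat /cube_side.
  rewrite (_ : n * _ ^ 2 = 4 * n ^ 3 * W * W); last by ring.
  rewrite (_ : 4 * n ^ 4 * W * _ = 4 * n ^ 3 * W * (pair_weight S * n)); last by ring.
  by rewrite leq_mul2l pair_weight_ge orbT.
have -> : ((n * (2 * n * W) ^ 2)%:Z = \sum_(v : V) ((2 * n * W) ^ 2)%:Z)%R.
  by rewrite sumr_const PoszM; ring.
apply: ler_sum => v _; rewrite /gradient.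
have load_bound : padded_card S * load x v <= 2 * n * W.
  by rewrite -mulnA mulnCA leq_mul ?padded_card_le ?load_le.
have weight_bound : pair_weight S <= 2 * n * W.
  by apply: leq_trans (pair_weight_subset (subsetT S)) _; rewrite leq_pmull ?muln_gt0.
by move: (padded_card S * load x v) (2 * n * W) load_bound weight_bound => y z; nia.
Qed.

Lemma sqdist_step (H : {set V}) :
  (forall u, ratio_le (level x u) S) -> k <= #|H| -> doubles H S ->
  (n%:Z * sqdist H (step S x) + (M * W)%:Z <= n%:Z * sqdist H x)%R.
Proof.
move=> levels_le kH dbl.
have decrease : (sqdist H (step S x) + (M * pair_weight S)%:Z <= sqdist H x)%R.
  have := sqdist_step_le S H x_le; rewrite sqdist_expand.
  have := gradient_point_le levels_le.
  have : ((M * (pair_weight S * k))%:Z <= M%:Z * \sum_(v in H) gradient S x v)%R.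
    by rewrite PoszM ler_wpM2l ?gradient_set_ge.
  have := gradient_sqr_le.
  rewrite (_ : M * (pair_weight S * k) = M * (pair_weight S * k.-1) + M * pair_weight S).
    by lia.
  by rewrite -mulnDr -mulnSr prednK.
have := leq_mul (leqnn M) pair_weight_ge; nia.
Qed.

End Step.

Lemma ascending_step t x x' S S' :
  k <= n -> ascending t x S -> ratio_le S S' -> (forall u, ratio_le (level x u) S') ->
  (forall v, x' v = step S' x v) -> ascending t.+1 x' S'.
Proof.
move=> kn [x_le S_ge dist_le] leSS' levels_le x'E.
have S'_ge := ratio_le_trans S_ge leSS'.
split=> // [v|H kH dbl]; first by rewrite x'E geq_minr.
apply: le_trans (dist_le H kH (doubles_ratio_le leSS' dbl)).
rewrite mulSn PoszD addrA lerD2r.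
rewrite (_ : sqdist H x' = sqdist H (step S' x)); first exact: sqdist_step.
by apply: eq_bigr => v _; rewrite x'E.
Qed.

Lemma ascending_half_optimal x S : 0 < n -> ascending rounds x S -> half_optimal S.
Proof.
move=> n_gt0 [_ _ dist_le] H kH; apply/negP => dbl.
have W_gt0 : 0 < W.
  apply: leq_trans (pair_weight_subset (subsetT H)); move: dbl; rewrite /doubles.
  by case: (pair_weight H) => //; rewrite muln0.
have sqdist_ge0 : (0 <= n%:Z * sqdist H x)%R.
  by rewrite mulr_ge0 // sumr_ge0 // => v _; apply: sqr_ge0.
have M_gt0 : 0 < M by rewrite /cube_side !muln_gt0 n_gt0 W_gt0.
have : n * n * M ^ 2 < rounds * (M * W).
  rewrite (_ : n * n * M ^ 2 = M * W * (4 * n ^ 6)); last by rewrite /cube_side; ring.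
  by rewrite [ltnRHS]mulnC ltn_pmul2l ?ltnSn // muln_gt0 M_gt0.
rewrite ltnNge -lez_nat => /negP[]; apply: le_trans (dist_le H kH dbl).
by rewrite lerDr.
Qed.

End Ascent.

Section Padding.
Variables (V : finType) (k : nat).

Definition pad_step (S : {set V}) (u : V) : {set V} :=
  if (u \notin S) && (#|S| < k) then u |: S else S.

(* [S'] comes from [S] by applying [pad_step] at the vertices of [A]. *)
Definition padding (S A S' : {set V}) : Prop :=
  [/\ S \subset S', #|S'| <= padded_card k S & #|S'| < k -> A \subset S'].

Lemma padding_init S : padding S set0 S.
Proof. by split; rewrite ?sub0set ?leq_maxr. Qed.

Lemma padding_step S A S' u :
  padding S A S' -> padding S (u |: A) (pad_step S' u).
Proof.
rewrite /pad_step => -[sSS' card_le sAS'].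
case: ifPn => [/andP[uS' lt_k]|]; last first.
  rewrite negb_and negbK => uS'; split=> // lt_k.
  by rewrite lt_k orbF in uS'; rewrite subUset sub1set uS' sAS'.
split; first exact: subset_trans sSS' (subsetUr _ _).
- by rewrite cardsU1 uS' /= leq_max add1n lt_k.
- by move=> _; rewrite setUS ?sAS'.
Qed.

Lemma card_padding S S' : k <= #|V| -> padding S setT S' -> #|S'| = padded_card k S.
Proof.
move=> kV [sSS' card_le sTS']; apply/eqP; rewrite eqn_leq card_le geq_max.
rewrite subset_leq_card // andbT leqNgt; apply/negP => lt_k.
by have := subset_leq_card (sTS' lt_k); rewrite cardsT leqNgt (leq_trans lt_k kV).
Qed.

End Padding.

(** * The program *)

(* [Scale] is the product of the denominators of the weights and [Side] the side
   of the cube.  [BestWeight] and [BestSize] are the [pair_weight] and the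
   [padded_card] of [BestSet]; [Count], [Sum] and [Size] measure the current set.
   [Weight] is the matrix of the integer weights, row by row. *)
Inductive var : Type :=
| Input
| Vertices | MinSize | Scale | TotalWeight | Side | Rounds | BestWeight | BestSize
| Round | Vertex | Index | Count | Sum | Size
| Weight | Point | BestSet | Loads.

Scheme Boolean Equality for var.

Lemma var_beqP : Equality.axiom var_beq.
Proof. by move=> x y; apply: (iffP idP) => [|->]; [case: x; case: y | case: y]. Qed.

HB.instance Definition _ := hasDecEq.Build var var_beqP.

Definition vars : seq var :=
  [:: Input; Vertices; MinSize; Scale; TotalWeight; Side; Rounds; BestWeight; BestSize;
      Round; Vertex; Index; Count; Sum; Size; Weight; Point; BestSet; Loads].

Lemma index_varsK : cancel (index^~ vars) (nth Input vars).
Proof. by case. Qed.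

HB.instance Definition _ := Countable.copy var (can_type index_varsK).

Lemma vars_enum : Finite.axiom vars.
Proof. by case. Qed.

HB.instance Definition _ := isFinite.Build var vars_enum.

Definition scalar (v : var) : pexpr var := Cell v (Const _ 0).
Coercion scalar : var >-> pexpr.

Definition constant (c : nat) : pexpr var := Const _ c.
Coercion constant : nat >-> pexpr.

Declare Scope prog_scope.
Delimit Scope prog_scope with prog.
Bind Scope prog_scope with pexpr.
Bind Scope prog_scope with prog.

Notation "v .[ i ]" := (Cell v i) : prog_scope.
Infix "+" := Add : prog_scope.
Infix "-" := Sub : prog_scope.
Infix "*" := Mul : prog_scope.
Infix "%/" := Div : prog_scope.
(* 1 if the comparison holds and 0 otherwise, as subtraction is truncated. *)
Notation "e1 <= e2" := (1 - (e1 - e2))%prog : prog_scope.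
Notation "e1 < e2" := (e1 + 1 <= e2)%prog : prog_scope.
Notation "v ::= e" := (Assign v 0 e) (at level 60) : prog_scope.
Notation "p1 ;; p2" := (Then p1 p2) (at level 61, right associativity) : prog_scope.

Section Code.
Local Open Scope prog_scope.

Definition square : pexpr var := Vertices * Vertices.

Definition numerator : pexpr var := Input.[2 + 2 * Index].
Definition denominator : pexpr var := Input.[3 + 2 * Index].

Definition integer_weights : prog var :=
  MinSize ::= Input.[1] ;;
  fold_loop Scale Index square 1 (Scale * denominator) ;;
  map_loop Weight Index square (numerator * (Scale %/ denominator)).

Definition initialize : prog var :=
  sum_loop TotalWeight Index square Weight.[Index] ;;
  Side ::= 4 * (square * square) * TotalWeight ;;
  Rounds ::= 4 * (square * square * square) + 1 ;;
  map_loop Point Index Vertices Side ;;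
  map_loop BestSet Index Vertices 1 ;;
  BestWeight ::= TotalWeight ;;
  BestSize ::= Vertices.

Definition row_index : pexpr var := Index %/ Vertices.
Definition column_index : pexpr var := Index - row_index * Vertices.
Definition in_level (e : pexpr var) : pexpr var := Point.[Vertex] <= Point.[e].

Definition measure_level : prog var :=
  sum_loop Count Index Vertices (in_level Index) ;;
  sum_loop Sum Index square (Weight.[Index] * (in_level row_index * in_level column_index)) ;;
  Size ::= MinSize + (Count - MinSize).

Definition select_level : prog var :=
  BestWeight ::= Sum ;;
  BestSize ::= Size ;;
  map_loop BestSet Index Vertices (in_level Index).

Definition test_level : prog var :=
  measure_level ;;
  When (Sum * BestSize - BestWeight * Size) select_level.

Definition scan_levels : prog var := For Vertex Vertices test_level.

Definition compute_loads : prog var :=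
  For Vertex Vertices
    (sum_loop Sum Index Vertices
       (Weight.[Vertex * Vertices + Index] *
        ((Point.[Vertex] <= Point.[Index]) + (Point.[Vertex] < Point.[Index]))) ;;
     Assign Loads Vertex Sum).

Definition moved : pexpr var := Point.[Index] + BestSize * Loads.[Index] - BestWeight.

Definition move_point : prog var :=
  map_loop Point Index Vertices (moved - (moved - Side)).

Definition ascent_round : prog var := scan_levels ;; compute_loads ;; move_point.

Definition ascent : prog var := For Round Rounds ascent_round.

Definition pad_vertex : prog var :=
  When ((1 - BestSet.[Vertex]) * (MinSize - Count))
    (Assign BestSet Vertex 1 ;; Count ::= Count + 1).

Definition pad : prog var :=
  sum_loop Count Index Vertices BestSet.[Index] ;; For Vertex Vertices pad_vertex.

(* Cell 0, which still holds the address of the variables, is left to [epilogue]. *)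
Definition copy_tail : prog var :=
  For Index (Vertices - 1) (Assign Input (Index + 1) BestSet.[Index + 1]).

Definition main : prog var :=
  integer_weights ;; initialize ;; ascent ;; pad ;; copy_tail.

End Code.

(* The input occupies the cells below [2 + 2 n^2]; no low cell is free, so the
   address of the variables replaces n in cell 0. *)
Definition base_expr : expr :=
  EAdd (ECst 2) (EMul (ECst 2) (EMul (EGet (ECst 0)) (EGet (ECst 0)))).

Definition prologue : cmd :=
  Seq (Store (EAdd base_expr (ECst (code Vertices))) (EGet (ECst 0)))
      (Store (ECst 0) base_expr).

Definition epilogue : cmd := Store (ECst 0) (compile_expr Input BestSet.[0]%prog).

Definition algorithm : cmd := Seq prologue (Seq (compile Input main) epilogue).

(** * Correctness of the program *)

Lemma big_ord_mul (R : Type) (idx : R) {op : Monoid.law idx} m n (F : nat -> R) :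
  \big[op/idx]_(p < m * n) F p = \big[op/idx]_(i < m) \big[op/idx]_(j < n) F (i * n + j).
Proof.
rewrite -(big_mkord xpredT F) big_nat_mul big_mkord; apply: eq_bigr => i _.
rewrite -{1}[i * n]add0n big_addn mulSn addnK big_mkord.
by apply: eq_bigr => j _; rewrite addnC.
Qed.

Lemma leq_indicator x y : 1 - (x - y) = (x <= y).
Proof. by case: leqP; lia. Qed.

Definition row_major n (a : nat -> nat) (i j : 'I_n) : nat := a (i * n + j).

Lemma row_major_lt n (i j : 'I_n) : i * n + j < n * n.
Proof. by have := ltn_ord i; have := ltn_ord j; nia. Qed.

Lemma pair_weight_rowT n a : pair_weight (@row_major n a) setT = \sum_(p < n * n) a p.
Proof. by rewrite pair_weightT big_ord_mul. Qed.

(* On an input of [N] bits, the cube has side at most [4 * (2 ^ N) ^ 5], and there are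
   at most [4 * N ^ 6 + 1] rounds. *)
Definition word_length (N : nat) : nat := 8 * N.
Definition loop_bound (N : nat) : nat := 4 * N ^ 6 + 2.
Definition base_address (n : nat) : nat := 2 + 2 * (n * n).

Lemma base_address_gt0 n : 0 < base_address n.
Proof. by []. Qed.

Definition input_num (m : memory) (p : nat) : nat := m (2 + 2 * p).
Definition input_den (m : memory) (p : nat) : nat := m (3 + 2 * p).

Definition int_weight (n : nat) (m : memory) (p : nat) : nat :=
  input_num m p * ((\prod_(q < n * n) input_den m q) %/ input_den m p).

(* The side condition of [frame] is decided by computation. *)
Ltac frames := repeat
  match goal with H : frame _ _ ?s |- context [?s ?v] => rewrite (H v (erefl true)) end.

Section Specifications.
Variables n k N : nat.

Local Notation L := (word_length N).
Local Notation Z := (loop_bound N).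
Local Notation b := (base_address n).
Local Notation T := (rounds 'I_n).
Local Notation triple := (triple Input b L Z).
Local Notation point s := (fun v : 'I_n => s Point v).

Hypothesis kn : 0 < k <= n.
Hypothesis b_le : b <= N.

Let k_gt0 : 0 < k. Proof. by case/andP: kn. Qed.
Let n_gt0 : 0 < n. Proof. by case/andP: kn; apply: leq_trans. Qed.
Let card_le (S : {set 'I_n}) : #|S| <= n.
Proof. by rewrite -[leqRHS](card_ord n) max_card. Qed.

Let N_lt : 3 < N.
Proof. by apply: leq_trans b_le; have := n_gt0; rewrite /base_address; nia. Qed.

Let square_lt : n * n < N.
Proof. by apply: leq_trans b_le; rewrite /base_address; lia. Qed.

Let n_ltN : n < N.
Proof. by apply: leq_ltn_trans square_lt; rewrite leq_pmulr ?n_gt0. Qed.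

Let exp_lt e : e < 8 -> (2 ^ N) ^ e < 2 ^ L.
Proof. by move=> e_lt; rewrite -expnM ltn_exp2l // mulnC ltn_pmul2r // (ltn_trans _ N_lt). Qed.

Lemma lt_word_length x : x <= 2 ^ N -> x < 2 ^ L.
Proof. by move=> x_le; apply: leq_ltn_trans (exp_lt (isT : 1 < 8)); rewrite expn1. Qed.

Let leN_lt x : x <= N -> x < 2 ^ L.
Proof. by move=> x_le; apply: lt_word_length; apply: leq_trans x_le (ltnW (ltn_expl N _)). Qed.

Let bool_lt (c : bool) : c < 2 ^ L.
Proof. by apply: leN_lt; apply: leq_trans (ltnW N_lt); case: c. Qed.

Lemma base_address_lt : b < 2 ^ L. Proof. exact: leN_lt. Qed.
Let b_gt0 := base_address_gt0 n.
Let b_lt := base_address_lt.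
Let n_lt : n < 2 ^ L. Proof. exact/leN_lt/ltnW/n_ltN. Qed.
Let square_ltL : n * n < 2 ^ L. Proof. exact/leN_lt/ltnW/square_lt. Qed.

Let N_ltZ : N < Z.
Proof.
rewrite /loop_bound addn2 ltnS leqW // -[leqLHS]mul1n leq_mul //.
by rewrite -{1}(expn1 N) leq_pexp2l // (ltn_trans _ N_lt).
Qed.

Let n_ltZ : n < Z. Proof. exact: ltn_trans n_ltN N_ltZ. Qed.
Let square_ltZ : n * n < Z. Proof. exact: ltn_trans square_lt N_ltZ. Qed.

Let rounds_ltZ : T < Z.
Proof.
rewrite /rounds /loop_bound card_ord addn2 !ltnS leq_mul // leq_exp2r //.
exact: ltnW n_ltN.
Qed.

Let four_exp_le e : 4 * (2 ^ N) ^ e <= (2 ^ N) ^ e.+1.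
Proof. by rewrite expnS leq_mul // (@leq_exp2l 2 2) // ltnW // ltnW // N_lt. Qed.

Let rounds_lt : T < 2 ^ L.
Proof.
apply: leq_ltn_trans (exp_lt (isT : 7 < 8)); apply: leq_trans (four_exp_le 6).
rewrite /rounds card_ord ltn_pmul2l // ltn_exp2r //.
exact: ltn_trans n_ltN (ltn_expl N _).
Qed.

Let padded_card_lt (S : {set 'I_n}) : padded_card k S < 2 ^ L.
Proof. by apply: leq_ltn_trans n_lt; rewrite geq_max card_le andbT; case/andP: kn. Qed.

Hint Resolve n_lt n_ltZ square_ltL square_ltZ : core.
Hint Resolve bool_lt rounds_lt rounds_ltZ padded_card_lt : core.

Lemma integer_weights_spec m s : s Input = m -> s Vertices 0 = n -> m 1 = k ->
  (forall i, i <= n * n -> \prod_(p < i) input_den m p <= 2 ^ N) ->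
  (forall p, p < n * n -> int_weight n m p <= 2 ^ N) ->
  triple integer_weights s (fun s' =>
    s' MinSize 0 = k /\ forall p, p < n * n -> s' Weight p = int_weight n m p).
Proof.
move=> sm sn mk prod_le weight_le.
have read s' x : s' Input = m -> 0 < x < b -> mem_of Input b s' x = m x.
  by move=> inp x_in; rewrite mem_of_input ?inp.
have num_eq s' p : s' Input = m -> p < n * n ->
    mem_of Input b s' (2 + 2 * p) = input_num m p.
  by move=> inp p_lt; rewrite read // /base_address; lia.
have den_eq s' p : s' Input = m -> p < n * n ->
    mem_of Input b s' (3 + 2 * p) = input_den m p.
  by move=> inp p_lt; rewrite read // /base_address; lia.
apply: triple_then.
  apply: (triple_set b_gt0 b_lt (x := k)) => //=; first by rewrite read.
  by apply: leq_ltn_trans n_lt; case/andP: kn.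
move=> s1 f1 min_size; apply: triple_then.
  apply: (triple_fold b_gt0 b_lt (N := n * n)
    (g := fun i => \prod_(p < i) input_den m p)) => //=.
  - by move=> i i_le; apply/lt_word_length/prod_le.
  - by rewrite big_ord0.
  - by move=> s' f; frames; rewrite sn.
  - by move=> s' p p_lt f j_eq acc; rewrite acc j_eq den_eq ?big_ord_recr //; frames.
move=> s2 f2 scale; apply: triple_conseq.
  apply: (triple_map b_gt0 b_lt (N := n * n) (F := int_weight n m)) => //=.
  - by move=> p p_lt; apply/lt_word_length/weight_le.
  - by move=> s' f; frames; rewrite sn.
  - move=> s' p p_lt f j_eq _; rewrite j_eq num_eq ?den_eq //; by frames; rewrite ?scale.
by move=> s3 f3 weights; split=> //; frames.
Qed.

Definition stores_set (s : state var) (S : {set 'I_n}) : Prop :=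
  forall v : 'I_n, s BestSet v = (v \in S).

Definition pad_state (S A : {set 'I_n}) (s : state var) : Prop :=
  exists S', [/\ stores_set s S', s Count 0 = #|S'| & padding k S A S'].

Lemma pad_vertex_spec s S A (u : 'I_n) :
  s MinSize 0 = k -> s Vertex 0 = u -> pad_state S A s ->
  triple pad_vertex s (pad_state S (u |: A)).
Proof.
move=> sk su [S' [set_eq count padS']]; have uS' : s BestSet u = (u \in S') by [].
have := padding_step u padS'; rewrite /pad_step => padS''.
have condE : (1 - s BestSet u) * (s MinSize 0 - s Count 0) != 0 = (u \notin S') && (#|S'| < k).
  by rewrite uS' sk count; case: (u \in S') => //=; rewrite mul1n -lt0n subn_gt0.
apply: (triple_when b_gt0 b_lt) => /=; rewrite su.
  rewrite condE => missing; rewrite missing in padS''; have /andP[uNS' lt_k] := missing.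
  apply: triple_then.
    apply: (triple_assign b_gt0 b_lt (c := u) (x := 1)) => //=.
    exact: (bool_lt true).
  move=> s1 f1 set1; apply: triple_conseq.
    apply: (triple_set b_gt0 b_lt (x := #|S'|.+1)) => //=.
      by frames; rewrite count addn1.
    by apply: leq_ltn_trans n_lt; apply: leq_trans lt_k _; case/andP: kn.
  move=> s2 f2 count2; exists (u |: S'); split=> //; last by rewrite cardsU1 uNS'.
  move=> v; frames; rewrite set1 /= !inE -val_eqE /=.
  by case: eqP => _ //; rewrite set_eq.
move/eqP; rewrite -[_ == 0]negbK condE => /negPf skip; rewrite skip in padS''.
by exists S'.
Qed.

Lemma pad_spec s S : s Vertices 0 = n -> s MinSize 0 = k -> stores_set s S ->
  triple pad s (fun s' => s' Vertices 0 = n /\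
    exists S' : {set 'I_n}, [/\ S \subset S', #|S'| = padded_card k S & stores_set s' S']).
Proof.
move=> sn sk set_eq.
have card_sum : \sum_(v < n) s BestSet v = #|S|.
  by rewrite -sum1_card [RHS]big_mkcond; apply: eq_bigr => v _; rewrite set_eq; case: ifP.
apply: triple_then.
  apply: (triple_sum b_gt0 b_lt (N := n) (F := s BestSet)) => //=.
  - by rewrite card_sum; apply: leq_ltn_trans (card_le S) n_lt.
  - by move=> s' f; frames.
  - by move=> s' i _ f i_eq; frames; rewrite i_eq.
rewrite card_sum => s1 f1 count.
pose visited i := [set v : 'I_n | v < i].
apply: triple_conseq.
  apply: (triple_for b_gt0 b_lt (N := n) (Inv := fun i => pad_state S (visited i))) => //.
  - by move=> s' f /=; frames.
  - move=> s' f; exists S; rewrite (_ : visited 0 = set0); last first.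
      by apply/setP => v; rewrite !inE.
    by split; [move=> v; frames | frames | exact: padding_init].
  move=> i s2 iN f2 i_eq pad2.
  apply: triple_conseq (pad_vertex_spec (u := Ordinal iN) _ _ pad2) _; [by frames | by [] |].
  move=> s3 _ [S' [set3 count3 pad3]] s4 f4; exists S'.
  split; [by move=> v; frames | by frames |].
  rewrite (_ : visited i.+1 = Ordinal iN |: visited i) //.
  by apply/setP => v; rewrite !inE ltnS leq_eqVlt.
move=> s' f' [S' [set' _ pad']]; split; first by frames.
exists S'; split=> //; first by case: pad'.
apply: card_padding; first by rewrite card_ord; case/andP: kn.
by rewrite (_ : setT = visited n) //; apply/setP => v; rewrite !inE ltn_ord.
Qed.

Lemma copy_tail_spec s : s Vertices 0 = n ->
  triple copy_tail s (fun s' => forall i, 0 < i < n -> s' Input i = s BestSet i).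
Proof.
move=> sn.
pose Inv i s' := forall j, 0 < j <= i -> s' Input j = s BestSet j.
apply: triple_conseq (_ : triple _ _ (Inv n.-1)) _; last first.
  by move=> s' _ out i /andP[i_gt0 i_lt]; rewrite out // i_gt0 -ltnS prednK // n_gt0.
apply: (triple_for b_gt0 b_lt) => //.
- by apply: leq_ltn_trans n_ltZ; apply: leq_pred.
- by apply: leq_ltn_trans n_lt; apply: leq_pred.
- by move=> s' f /=; frames; rewrite sn subn1.
- by move=> s' _ i /andP[i_gt0]; rewrite leqn0 => /eqP i0; rewrite i0 in i_gt0.
move=> i s1 iN f1 i_eq out1; apply: triple_bounded => s1_small; apply: triple_conseq.
  apply: (triple_assign b_gt0 b_lt (c := i.+1) (x := s BestSet i.+1)) => /=.
  - by rewrite i_eq addn1.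
  - by frames; rewrite i_eq addn1.
  - by rewrite /writable /= /base_address; have := n_gt0; move: iN; nia.
  - by have := s1_small BestSet i.+1; frames.
move=> s2 _ out2 s3 f3 j; frames; rewrite out2 /=.
case: eqP => [-> //|j_neq] /andP[j_gt0 j_le]; apply: out1; lia.
Qed.

Variable a : nat -> nat.

Local Notation w := (@row_major n a).
Local Notation W := (pair_weight w setT).
Local Notation M := (cube_side w).

Hypothesis W_le : W <= 2 ^ N.

Let W_lt : W < 2 ^ L.
Proof. exact: lt_word_length. Qed.

Let pair_weight_lt S : pair_weight w S < 2 ^ L.
Proof. exact: leq_ltn_trans (pair_weight_subset _ (subsetT S)) W_lt. Qed.

Let load_lt x v : load w x v < 2 ^ L.
Proof.
apply: leq_ltn_trans (load_le _ _ _) _; apply: leq_ltn_trans (exp_lt (isT : 2 < 8)).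
apply: leq_trans (leq_mul (leqnn 2) W_le) (leq_trans _ (four_exp_le 1)).
by rewrite expn1 leq_mul.
Qed.

Let M_lt : M < 2 ^ L.
Proof.
apply: leq_ltn_trans (exp_lt (isT : 6 < 8)); apply: leq_trans (four_exp_le 5).
rewrite /cube_side card_ord -mulnA leq_mul // (expnSr (2 ^ N) 4) leq_mul //.
by rewrite leq_exp2r // ltnW // (ltn_trans n_ltN (ltn_expl N _)).
Qed.

Hint Resolve W_lt pair_weight_lt load_lt M_lt : core.

Definition parameters (s : state var) : Prop :=
  [/\ s Vertices 0 = n, s MinSize 0 = k, s Side 0 = M, s Rounds 0 = T &
      forall p, p < n * n -> s Weight p = a p].

Definition stores_best (s : state var) (S : {set 'I_n}) : Prop :=
  [/\ stores_set s S, s BestWeight 0 = pair_weight w S &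
      s BestSize 0 = padded_card k S].

Lemma parameters_frame l s s' : parameters s -> frame l s s' ->
  ~~ has (mem [:: Vertices; MinSize; Side; Rounds; Weight]) l -> parameters s'.
Proof. by move=> [? ? ? ? ?] f /(frame_disjoint f) same; split; rewrite ?same. Qed.

Lemma stores_best_frame l s s' S : stores_best s S -> frame l s s' ->
  ~~ has (mem [:: BestWeight; BestSize; BestSet]) l -> stores_best s' S.
Proof.
by move=> [? ? ?] f /(frame_disjoint f) same; split; rewrite /stores_set ?same.
Qed.

Lemma initialize_spec s : s Vertices 0 = n -> s MinSize 0 = k ->
  (forall p, p < n * n -> s Weight p = a p) ->
  triple initialize s (fun s' => [/\ parameters s', stores_best s' setT &
    forall v, v < n -> s' Point v = M]).
Proof.
move=> sn sk sa; apply: triple_then.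
  apply: (triple_sum b_gt0 b_lt (N := n * n) (F := a)) => //=.
  - by rewrite -pair_weight_rowT.
  - by move=> s' f; frames; rewrite sn.
  - by move=> s' p p_lt f p_eq; frames; rewrite p_eq sa.
rewrite -pair_weight_rowT => s1 f1 total; apply: triple_then.
  apply: (triple_set b_gt0 b_lt (x := M)) => //=.
  by frames; rewrite total sn /cube_side card_ord; ring.
move=> s2 f2 side; apply: triple_then.
  apply: (triple_set b_gt0 b_lt (x := T)) => //=.
  by frames; rewrite sn /rounds card_ord; ring.
move=> s3 f3 rounds_eq; apply: triple_then.
  apply: (triple_map b_gt0 b_lt (N := n) (F := fun=> M)) => //=.
  - by move=> s' f; frames.
  - by move=> s' i _ f _ _; frames.
move=> s4 f4 points; apply: triple_then.
  apply: (triple_map b_gt0 b_lt (N := n) (F := fun=> 1)) => //=.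
  - by move=> i _; apply: (bool_lt true).
  - by move=> s' f; frames.
move=> s5 f5 full; apply: triple_then.
  by apply: (triple_set b_gt0 b_lt (x := W)) => //=; frames.
move=> s6 f6 weight_eq; apply: triple_conseq.
  by apply: (triple_set b_gt0 b_lt (x := n)) => //=; frames.
move=> s7 f7 size_eq; split.
- by split; frames => // p p_lt; frames; rewrite sa.
- split; last 1 first.
  + by rewrite size_eq /padded_card cardsT card_ord; apply/esym/maxn_idPr; case/andP: kn.
  + by move=> v; rewrite inE; frames; rewrite full.
  + by frames.
- by move=> v v_lt; frames; rewrite points.
Qed.

Lemma card_level_sum (x : nat -> nat) (u : 'I_n) :
  \sum_(v < n) ((x u <= x v) : nat) = #|level (fun v : 'I_n => x v) u|.
Proof. by rewrite -sum1dep_card [RHS]big_mkcond. Qed.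

Lemma pair_weight_level_sum (x : nat -> nat) (u : 'I_n) :
  \sum_(p < n * n) a p * ((x u <= x (p %/ n)) * (x u <= x (p - p %/ n * n))) =
  pair_weight w (level (fun v : 'I_n => x v) u).
Proof.
rewrite (big_ord_mul n n
  (fun p => a p * ((x u <= x (p %/ n)) * (x u <= x (p - p %/ n * n))))).
rewrite /pair_weight [RHS]big_mkcond; apply: eq_bigr => i _.
have rowE (j : 'I_n) : (i * n + j) %/ n = i.
  by rewrite divnMDl ?n_gt0 // divn_small // addn0.
rewrite inE; case: ifP => x_le; last first.
  by rewrite big1 // => j _; rewrite rowE x_le muln0.
rewrite [RHS]big_mkcond; apply: eq_bigr => j _.
by rewrite rowE x_le addKn inE mul1n; case: ifP; rewrite ?muln1 ?muln0.
Qed.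

Lemma measure_level_spec s (u : 'I_n) : parameters s -> s Vertex 0 = u ->
  triple measure_level s (fun s' =>
    s' Sum 0 = pair_weight w (level (point s) u) /\
    s' Size 0 = padded_card k (level (point s) u)).
Proof.
move=> [sn sk _ _ sa] su; set lv := level _ u.
apply: triple_then.
  apply: (triple_sum b_gt0 b_lt (N := n) (F := fun v => (s Point u <= s Point v) : nat)) => //=.
  - by rewrite card_level_sum; apply: leq_ltn_trans (card_le _) n_lt.
  - by move=> s' f; frames.
  - by move=> s' i _ f j_eq; frames; rewrite su j_eq leq_indicator.
rewrite card_level_sum -/lv => s1 f1 count; apply: triple_then.
  apply: (triple_sum b_gt0 b_lt (N := n * n) (F := fun p =>
    a p * ((s Point u <= s Point (p %/ n)) * (s Point u <= s Point (p - p %/ n * n))))) => //=.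
  - by rewrite pair_weight_level_sum.
  - by move=> s' f; frames; rewrite sn.
  - by move=> s' p p_lt f j_eq; frames; rewrite su j_eq sn sa // !leq_indicator.
rewrite pair_weight_level_sum -/lv => s2 f2 sum; apply: triple_conseq.
  apply: (triple_set b_gt0 b_lt (x := padded_card k lv)) => //=.
  by frames; rewrite count sk -maxnE.
by move=> s3 f3 size; split=> //; frames.
Qed.

Lemma select_level_spec s (u : 'I_n) : parameters s -> s Vertex 0 = u ->
  s Sum 0 = pair_weight w (level (point s) u) ->
  s Size 0 = padded_card k (level (point s) u) ->
  triple select_level s (stores_best ^~ (level (point s) u)).
Proof.
move=> [sn _ _ _ _] su; set lv := level _ u => sum size.
apply: triple_then.
  by apply: (triple_set b_gt0 b_lt (x := pair_weight w lv)) => //=; rewrite sum.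
move=> s1 f1 weight_eq; apply: triple_then.
  by apply: (triple_set b_gt0 b_lt (x := padded_card k lv)) => //=; frames; rewrite size.
move=> s2 f2 size_eq; apply: triple_conseq.
  apply: (triple_map b_gt0 b_lt (N := n) (F := fun v => (s Point u <= s Point v) : nat)) => //=.
  - by move=> s' f; frames.
  - by move=> s' i _ f j_eq _; frames; rewrite su j_eq leq_indicator.
move=> s3 f3 set_eq; split=> [v||]; last 2 first.
- by frames.
- by frames.
by rewrite set_eq // inE.
Qed.

Lemma test_level_spec s S (u : 'I_n) :
  parameters s -> stores_best s S -> s Vertex 0 = u ->
  triple test_level s (fun s' => exists S', [/\ stores_best s' S',
    ratio_le w k S S' & ratio_le w k (level (point s) u) S']).
Proof.
move=> ps [sS sB sD] su; apply: triple_then; first exact: measure_level_spec ps su.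
move=> s1 f1 [sum size].
have ps1 : parameters s1 by apply: parameters_frame ps f1 _.
have point1 : s1 Point = s Point by frames.
rewrite -point1 in sum size *; set lv := level _ u in sum size *.
apply: (triple_when b_gt0 b_lt) => /=; frames; rewrite sum size sB sD.
  rewrite subn_eq0 -ltnNge => better; apply: triple_conseq.
    by apply: select_level_spec; rewrite ?sum ?size //; frames.
  move=> s2 _ best2; exists lv; split=> //; last exact: ratio_le_refl.
  by rewrite /ratio_le mulnC ltnW // mulnC.
move/eqP; rewrite subn_eq0 => worse; exists S; split=> //; last exact: ratio_le_refl.
by apply: stores_best_frame f1 _.
Qed.

Lemma scan_levels_spec s S : parameters s -> stores_best s S ->
  triple scan_levels s (fun s' => exists S', [/\ stores_best s' S',
    ratio_le w k S S' & forall u, ratio_le w k (level (point s) u) S']).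
Proof.
move=> ps bs; pose Inv i s' := exists S', [/\ stores_best s' S', ratio_le w k S S' &
  forall u : 'I_n, u < i -> ratio_le w k (level (point s) u) S'].
apply: triple_conseq.
  apply: (triple_for b_gt0 b_lt (Inv := Inv) (N := n)) => //.
  - by move=> s' f /=; frames; case: ps.
  - move=> s' f; exists S; split=> //; last exact: ratio_le_refl.
    exact: stores_best_frame f _.
  move=> i s1 iN f1 i_eq [S1 [best1 ratio1 levels1]].
  have ps1 : parameters s1 by apply: parameters_frame ps f1 _.
  have point1 : s1 Point = s Point by frames.
  apply: triple_conseq (test_level_spec (u := Ordinal iN) ps1 best1 i_eq) _.
  move=> s2 f2 [S2 [best2 ratio12 level_i]] s3 f3; rewrite point1 in level_i.
  exists S2; split; first exact: stores_best_frame f3 _.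
    exact: (ratio_le_trans k_gt0 ratio1 ratio12).
  move=> u; rewrite ltnS leq_eqVlt => /orP[/eqP u_eq|u_lt].
    by rewrite (_ : u = Ordinal iN) //; apply: ord_inj.
  exact: (ratio_le_trans k_gt0 (levels1 u u_lt) ratio12).
by move=> s' _ [S' [? ? levels]]; exists S'; split=> // u; apply: levels.
Qed.

Lemma compute_loads_spec s : parameters s ->
  triple compute_loads s (fun s' => forall u : 'I_n, s' Loads u = load w (point s) u).
Proof.
move=> ps; have [sn _ _ _ sa] := ps.
apply: triple_conseq (_ : triple _ _ (fun s' =>
    forall u : 'I_n, u < n -> s' Loads u = load w (point s) u)) _; last first.
  by move=> s' _ loads u; apply: loads.
apply: (triple_for b_gt0 b_lt
  (Inv := fun i s' => forall u : 'I_n, u < i -> s' Loads u = load w (point s) u)) => //.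
  by move=> s' f /=; frames.
move=> i s1 iN f1 i_eq loads1; pose u := Ordinal iN.
have point1 : s1 Point = s Point by frames.
pose F j := a (i * n + j) * ((s Point i <= s Point j) + (s Point i < s Point j)).
have FE : \sum_(j < n) F j = load w (point s) u by [].
apply: triple_then.
  apply: (triple_sum b_gt0 b_lt (N := n) (F := F)) => //=.
  - by rewrite FE.
  - by move=> s' f; frames.
  - move=> s' j jn f j_eq; frames; rewrite i_eq j_eq sn !leq_indicator addn1 sa //.
    exact: (row_major_lt u (Ordinal jn)).
rewrite FE => s2 f2 sum2; apply: triple_conseq.
  apply: (triple_assign b_gt0 b_lt (c := i) (x := load w (point s) u)) => //=.
  by frames.
move=> s3 f3 load3 s4 f4 v; frames; rewrite load3 /= ltnS leq_eqVlt.
case: eqP => [v_eq _|_ v_lt]; last by frames; apply: loads1.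
by congr (load _ _ _); apply: ord_inj.
Qed.

Lemma move_point_spec s S : parameters s -> stores_best s S ->
  (forall u : 'I_n, s Loads u = load w (point s) u) ->
  triple move_point s (fun s' => forall v : 'I_n, s' Point v = step w k S (point s) v).
Proof.
move=> [sn _ sM _ _] [_ sB sD] loads.
pose F v := minn (s Point v + padded_card k S * s Loads v - pair_weight w S) M.
apply: triple_conseq.
  apply: (triple_map b_gt0 b_lt (N := n) (F := F)) => //=.
  - by move=> i _; apply: leq_ltn_trans (geq_minr _ _) M_lt.
  - by move=> s' f; frames.
  - by move=> s' i _ f j_eq x_eq; rewrite j_eq x_eq; frames; rewrite sB sD sM -minnE.
by move=> s' f points v; rewrite points // /F loads.
Qed.

Hypothesis w_sym : forall i j, w i j = w j i.

Definition ascent_state (t : nat) (s : state var) : Prop :=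
  parameters s /\ exists2 S, stores_best s S & ascending w k t (point s) S.

Lemma ascent_state_frame s s' t :
  frame [:: Round] s s' -> ascent_state t s -> ascent_state t s'.
Proof.
move=> f [ps [S bs asc]]; split; first exact: parameters_frame f _.
by exists S; [apply: stores_best_frame f _ | frames].
Qed.

Lemma ascent_round_spec t s : ascent_state t s ->
  triple ascent_round s (ascent_state t.+1).
Proof.
move=> [ps [S bs asc]].
apply: triple_then (scan_levels_spec ps bs) _ => s1 f1 [S1 [bs1 leSS1 levels]].
have ps1 : parameters s1 by apply: parameters_frame ps f1 _.
apply: triple_then (compute_loads_spec ps1) _ => s2 f2 loads.
have ps2 : parameters s2 by apply: parameters_frame ps1 f2 _.
have bs2 : stores_best s2 S1 by apply: stores_best_frame bs1 f2 _.
have point2 : s2 Point = s Point by frames.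
rewrite (f1 Point) // -point2 in loads; rewrite -point2 in levels asc.
apply: triple_conseq (move_point_spec ps2 bs2 loads) _ => s3 f3 points.
split; first by apply: parameters_frame ps2 f3 _.
exists S1; first exact: stores_best_frame bs2 f3 _.
by apply: ascending_step asc leSS1 levels points; rewrite ?k_gt0 ?card_ord //; case/andP: kn.
Qed.

Lemma ascent_spec s : parameters s -> stores_best s setT ->
  (forall v, v < n -> s Point v = M) ->
  triple ascent s (fun s' => parameters s' /\
    exists2 S, stores_best s' S & half_optimal w k S).
Proof.
move=> ps bs points; apply: triple_conseq.
  apply: (triple_for b_gt0 b_lt (Inv := ascent_state) (N := T)) => //.
  - by move=> s' f /=; frames; case: ps.
  - move=> s' f; apply: ascent_state_frame f _; split=> //; exists setT => //.
    by apply: ascending_init => // v; apply: points.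
  move=> t s1 _ _ _ asc; apply: triple_conseq (ascent_round_spec asc) _ => s2 _ asc2 s3 f3.
  exact: ascent_state_frame f3 asc2.
move=> s' _ [ps' [S bs' asc]]; split=> //; exists S => //.
by apply: ascending_half_optimal asc; rewrite ?card_ord ?n_gt0.
Qed.

End Specifications.

Section Execution.
Variables (n k N : nat) (m : memory).

Local Notation L := (word_length N).
Local Notation Z := (loop_bound N).
Local Notation b := (base_address n).
Local Notation w := (@row_major n (int_weight n m)).

Hypothesis kn : 0 < k <= n.
Hypothesis b_le : b <= N.
Hypothesis W_le : pair_weight w setT <= 2 ^ N.
Hypothesis w_sym : forall i j, w i j = w j i.
Hypothesis prod_le : forall i, i <= n * n -> \prod_(p < i) input_den m p <= 2 ^ N.
Hypothesis m_le : forall x, m x <= 2 ^ N.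
Hypotheses (m0 : m 0 = n) (m1 : m 1 = k) (m_out : forall x, b <= x -> m x = 0).

Let b_gt0 : 0 < b := base_address_gt0 n.
Let b_lt : b < 2 ^ L := base_address_lt kn b_le.
Let m_lt x : m x < 2 ^ L := lt_word_length kn b_le (m_le x).

Definition solution (S S' : {set 'I_n}) : Prop :=
  [/\ S \subset S', #|S'| = padded_card k S & half_optimal w k S].

Lemma main_spec s : s Input = m -> s Vertices 0 = n ->
  triple Input b L Z main s (fun s' => exists S S', [/\ solution S S',
    stores_set s' S' & forall i, 0 < i < n -> s' Input i = s' BestSet i]).
Proof.
move=> sm sn.
have weight_le p : p < n * n -> int_weight n m p <= 2 ^ N.
  move=> p_lt; apply: leq_trans W_le; rewrite pair_weight_rowT.
  by rewrite (bigD1 (Ordinal p_lt)) //= leq_addr.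
apply: triple_then (integer_weights_spec kn b_le sm sn m1 prod_le weight_le) _.
move=> s1 f1 [sk sa].
apply: triple_then (initialize_spec kn b_le W_le _ sk sa) _; first by frames.
move=> s2 f2 [ps2 best2 points].
apply: triple_then (ascent_spec kn b_le W_le w_sym ps2 best2 points) _.
move=> s3 f3 [ps3 [S best3 opt]].
have [sn3 sk3 _ _ _] := ps3; have [set3 _ _] := best3.
apply: triple_then (pad_spec kn b_le sn3 sk3 set3) _.
move=> s4 f4 [sn4 [S' [sSS' card set4]]].
apply: triple_conseq (copy_tail_spec kn b_le sn4) _.
move=> s5 f5 copied; exists S, S'; split=> //; first by move=> v; frames.
by move=> i i_in; frames; apply: copied.
Qed.

Definition initial_state : state var :=
  state_upd (fun v i => if v == Input then m i else 0) Vertices 0 n.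

Lemma initial_state_lt : bounded L initial_state.
Proof.
move=> v i; rewrite /initial_state /state_upd; case: ifP => _.
  by rewrite -m0 m_lt.
by case: ifP => _; [exact: m_lt | rewrite expn_gt0].
Qed.

Lemma mem_of_initial_state :
  mem_of Input b initial_state = upd (upd m (b + code Vertices) n) 0 b.
Proof.
have locE : location Input b Vertices 0 = b + code Vertices.
  by rewrite /location /= muln0.
rewrite -upd_mem_of // locE; apply: functional_extensionality => x.
rewrite /upd /mem_of; have [->|x_neq0] := eqVneq x 0; first by rewrite /base_address.
have [//|_] := eqVneq x (b + code Vertices); rewrite eqxx.
by have [//|x_ge] := ltnP x b; rewrite (m_out x_ge); case: eqP.
Qed.

Lemma exec_prologue :
  exists2 t, exec prologue m t (mem_of Input b initial_state) &
    t <= L * cmd_weight Z prologue.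
Proof.
have L_gt0 := exponent_gt0 b_gt0 b_lt.
have base_eq m' : m' 0 = n -> eval m' base_expr = b by move=> /= ->.
have [||t1 run1 time1] := exec_store_le L_gt0 m_lt
    (a := EAdd base_expr (ECst (code Vertices))) (e := EGet (ECst 0))
    (x := b + code Vertices) (y := n).
- by rewrite -(base_eq m).
- by [].
have m1_lt x : upd m (b + code Vertices) n x < 2 ^ L.
  by rewrite /upd; case: ifP => // _; rewrite -m0.
have [||t2 run2 time2] := exec_store_le L_gt0 m1_lt
    (a := ECst 0) (e := base_expr) (x := 0) (y := b).
- by [].
- exact: base_eq.
rewrite mem_of_initial_state; exists (t1 + t2); first exact: exec_seq run1 run2.
by rewrite mulnDr leq_add.
Qed.

Lemma exec_epilogue s : bounded L s ->
  exists2 t, exec epilogue (mem_of Input b s) t (upd (mem_of Input b s) 0 (s BestSet 0)) &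
    t <= L * cmd_weight Z epilogue.
Proof.
move=> s_small; apply: exec_store_le.
- exact: exponent_gt0 b_gt0 b_lt.
- exact (mem_of_lt Input b_lt s_small).
- by [].
- by rewrite eval_compile.
Qed.

Lemma algorithm_exec :
  exists t m' S S', [/\ exec algorithm m t m', t <= L * cmd_weight Z algorithm,
    outputs m' S' & solution S S'].
Proof.
have [t1 run1 time1] := exec_prologue.
have [||//|t2 [s [run2 time2 s_small f [S [S' [sol set_eq copied]]]]]] :=
  main_spec (s := initial_state).
- by apply: functional_extensionality => i; rewrite /initial_state /state_upd eqxx.
- by rewrite /initial_state /state_upd !eqxx.
- exact: initial_state_lt.
have [t3 run3 time3] := exec_epilogue s_small.
exists (t1 + (t2 + t3)), (upd (mem_of Input b s) 0 (s BestSet 0)), S, S'; split=> //.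
- exact: exec_seq run1 (exec_seq run2 run3).
- by have := leq_add time1 (leq_add time2 time3); rewrite -!mulnDr.
move=> i; rewrite /upd; case: eqP => [i0|/eqP i_neq0]; first by rewrite -i0 set_eq.
rewrite mem_of_input ?copied ?set_eq // lt0n i_neq0 //=.
by apply: leq_trans (ltn_ord i) _; rewrite /base_address; nia.
Qed.

End Execution.

(** * The encoding *)

Lemma nth_allpairs (S T R : Type) (f : S -> T -> R) s t x0 y0 z0 i j :
  i < size s -> j < size t ->
  nth z0 [seq f x y | x <- s, y <- t] (i * size t + j) = f (nth x0 s i) (nth y0 t j).
Proof.
move=> + jt; elim: s i => //= x s IH [|i] is_lt; rewrite nth_cat size_map.
  by rewrite mul0n add0n jt (nth_map y0).
by rewrite mulSn -addnA ltnNge leq_addr /= addKn IH.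
Qed.

Lemma nth_flatten_uniform (T : Type) (x0 : T) (ss : seq (seq T)) c p i :
  all (fun s => size s == c) ss -> i < c ->
  nth x0 (flatten ss) (c * p + i) = nth x0 (nth [::] ss p) i.
Proof.
move=> + ic; elim: ss p => [|s ss IH] p /=; first by rewrite !nth_nil.
case/andP=> /eqP size_s /IH{}IH; rewrite nth_cat size_s.
case: p => [|p]; first by rewrite muln0 ic.
by rewrite mulnS -addnA ltnNge leq_addr /= addKn IH.
Qed.

Lemma size_flatten_uniform (T : Type) (ss : seq (seq T)) c :
  all (fun s => size s == c) ss -> size (flatten ss) = c * size ss.
Proof.
elim: ss => [|s ss IH] /=; first by rewrite muln0.
by case/andP=> /eqP size_s /IH size_ss; rewrite size_cat size_s size_ss mulnS.
Qed.

Lemma leq_sum_prod (F : nat -> nat) m : \sum_(p < m) F p <= \prod_(p < m) (F p).+1.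
Proof.
elim: m => [|m IH]; first by rewrite !big_ord0.
by rewrite !big_ord_recr /= mulnS leq_add // leq_pmull // prodn_gt0.
Qed.

Section Encoding.
Variables (n : nat) (G : wgraph n) (k : nat).

Local Notation m := (init_mem (encode G k)).
Local Notation N := (input_size (encode G k)).
Local Notation w := (@row_major n (int_weight n m)).
Local Notation P := (\prod_(p < n * n) input_den m p).

Definition adjacency (i j : 'I_n) : rat := if edge G i j then wt G i j else 0%R.

Definition encoded_entries : seq (seq nat) :=
  [seq encode_rat (adjacency i j) | i <- enum 'I_n, j <- enum 'I_n].

Lemma encodeE : encode G k = [:: n, k & flatten encoded_entries].
Proof. by []. Qed.

Lemma size_encoded_entry : all (fun s => size s == 2) encoded_entries.
Proof. by apply/allP => s /allpairsP[[i j] [_ _ ->]]. Qed.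

Lemma size_encode : size (encode G k) = base_address n.
Proof.
rewrite encodeE /= (size_flatten_uniform size_encoded_entry).
by rewrite size_allpairs !size_enum_ord.
Qed.

Lemma encode_nth (i j : 'I_n) c : c < 2 ->
  m (2 + (2 * (i * n + j) + c)) = nth 0 (encode_rat (adjacency i j)) c.
Proof.
move=> c_lt; rewrite /init_mem encodeE /= (nth_flatten_uniform _ _ size_encoded_entry) //.
congr (nth _ _ _); have {2}-> : n = size (enum 'I_n) by rewrite size_enum_ord.
by rewrite (nth_allpairs _ i j) ?size_enum_ord // !nth_ord_enum.
Qed.

Lemma encode_num (i j : 'I_n) : input_num m (i * n + j) = `|numq (adjacency i j)|.
Proof. by have := encode_nth i j (isT : 0 < 2); rewrite addn0. Qed.

Lemma encode_den (i j : 'I_n) : input_den m (i * n + j) = `|denq (adjacency i j)|.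
Proof. by have := encode_nth i j (isT : 1 < 2); rewrite addn1 addnS. Qed.

Lemma encode_out x : base_address n <= x -> m x = 0.
Proof. by move=> x_ge; rewrite /init_mem nth_default // size_encode. Qed.

Lemma base_address_le_input : base_address n <= N.
Proof. by rewrite -size_encode -sum1_size; apply: leq_sum. Qed.

Lemma prod_encode_le : \prod_(x <- encode G k) x.+1 <= 2 ^ N.
Proof. by rewrite expn_sum; apply: leq_prod => x _; apply: ltn_exp2_bits. Qed.

Lemma encode_le x : m x <= 2 ^ N.
Proof.
have [x_lt|x_ge] := ltnP x (size (encode G k)); last by rewrite /init_mem nth_default.
apply: leq_trans prod_encode_le; rewrite (big_nth 0) big_mkord (bigD1 (Ordinal x_lt)) //=.
by apply: leq_trans (leqnSn _) _; rewrite leq_pmulr // prodn_gt0.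
Qed.

Lemma prod_num_den_le :
  (\prod_(p < n * n) (input_num m p).+1) * (\prod_(p < n * n) (input_den m p).+1) <= 2 ^ N.
Proof.
apply: leq_trans prod_encode_le; rewrite encodeE !big_cons mulnA.
apply: leq_trans (leq_pmull _ _) => //; rewrite big_flatten big_allpairs_dep /=.
rewrite (big_ord_mul n n (fun p => (input_num m p).+1)).
rewrite (big_ord_mul n n (fun p => (input_den m p).+1)).
rewrite -big_split big_enum; apply: leq_prod => i _ /=.
rewrite -big_split big_enum; apply: leq_prod => j _ /=.
by rewrite encode_num encode_den !big_cons big_nil muln1.
Qed.

Lemma prod_den_le i : i <= n * n -> \prod_(p < i) input_den m p <= 2 ^ N.
Proof.
move=> i_le; apply: leq_trans prod_num_den_le.
apply: leq_trans (leq_pmull _ _); last by rewrite prodn_gt0.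
apply: leq_trans (_ : \prod_(p < i) (input_den m p).+1 <= _); first exact: leq_prod.
rewrite (big_ord_widen (n * n) (fun p => (input_den m p).+1)) // big_mkcond.
by apply: leq_prod => p _; case: ifP.
Qed.

Lemma pair_weight_encode_le : pair_weight w setT <= 2 ^ N.
Proof.
rewrite pair_weight_rowT; apply: leq_trans prod_num_den_le.
apply: leq_trans (_ : (\sum_(p < n * n) input_num m p) * P <= _).
  by rewrite big_distrl; apply: leq_sum => p _; rewrite leq_mul // leq_div.
by rewrite leq_mul // ?(leq_sum_prod (input_num m)) //; apply: leq_prod.
Qed.

Lemma prod_den_gt0 : 0 < P.
Proof.
rewrite (big_ord_mul n n (input_den m)); do 2!apply: prodn_gt0 => ?.
by rewrite encode_den absz_gt0 denq_neq0.
Qed.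

Lemma adjacency_sym i j : adjacency i j = adjacency j i.
Proof. by rewrite /adjacency edge_sym wt_sym. Qed.

Lemma adjacency_ge0 i j : (0 <= adjacency i j)%R.
Proof. by rewrite /adjacency; case: ifP => // /wt_pos/ltW. Qed.

Lemma int_weight_sym i j : w i j = w j i.
Proof. by rewrite /row_major /int_weight !encode_num !encode_den adjacency_sym. Qed.

Lemma int_weightE i j : ((w i j)%:R = P%:R * adjacency i j :> rat)%R.
Proof.
have dvd_P : input_den m (i * n + j) %| P.
  by rewrite (bigD1 (Ordinal (row_major_lt i j))) //= dvdn_mulr.
rewrite /row_major /int_weight natrM natf_div // mulrCA; congr (_ * _)%R.
rewrite encode_num encode_den !natr_absz (ger0_norm (denq_ge0 _)) ger0_norm.
  exact: divq_num_den.
by rewrite numq_ge0 adjacency_ge0.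
Qed.

Lemma pair_weight_weight (H : {set 'I_n}) :
  ((pair_weight w H)%:R = 2%:R * P%:R * weight G H :> rat)%R.
Proof.
pose upper (i j : 'I_n) : rat := if (i < j)%N then adjacency i j else 0%R.
have weightE : (weight G H = \sum_(i in H) \sum_(j in H) upper i j)%R.
  apply: eq_bigr => i _; rewrite big_mkcondr; apply: eq_bigr => j _.
  by rewrite /upper /adjacency; case: (i < j)%N.
have splitE i j : adjacency i j = (upper i j + upper j i)%R.
  rewrite /upper; case: ltngtP => [_|_|/ord_inj->]; rewrite ?addr0 ?add0r //.
    exact: adjacency_sym.
  by rewrite /adjacency edge_irr.
have -> : ((pair_weight w H)%:R =
    P%:R * \sum_(i in H) \sum_(j in H) (upper i j + upper j i))%R.
  rewrite /pair_weight natr_sum big_distrr; apply: eq_bigr => i _ /=.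
  rewrite natr_sum big_distrr; apply: eq_bigr => j _ /=.
  by rewrite int_weightE splitE.
under [X in (P%:R * X)%R]eq_bigr do rewrite big_split /=.
by rewrite big_split /= [X in (_ + X)%R]exchange_big /= -weightE; ring.
Qed.

End Encoding.

Local Open Scope ring_scope.

Lemma density_ge0 n (G : wgraph n) H : 0 <= density G H.
Proof.
rewrite divr_ge0 ?ler0n // sumr_ge0 // => i _; apply: sumr_ge0 => j.
by case/andP=> _ /andP[_ /wt_pos/ltW].
Qed.

(* Padding [S] to [S'] loses no weight and turns [padded_card k S] into a number of
   vertices. *)
Lemma solution_density n (G : wgraph n) k S S' :
  (0 < k)%N -> solution k (init_mem (encode G k)) S S' -> dal G k / 2%:R <= density G S'.
Proof.
move=> k_gt0 [sSS' card opt].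
have card_gt0 : 0 < #|S'|%:R :> rat by rewrite ltr0n card padded_card_gt0.
rewrite ler_pdivrMr ?ltr0n //; apply: bigmax_le => [|H kH].
  by rewrite mulr_ge0 ?ler0n ?density_ge0.
have H_gt0 : 0 < #|H|%:R :> rat by rewrite ltr0n (leq_trans k_gt0).
have := opt H kH; rewrite /doubles -leqNgt -card => le_SH.
have := leq_trans le_SH (leq_mul (leq_mul (leqnn 2) (pair_weight_subset _ sSS')) (leqnn _)).
rewrite -(ler_nat rat) !natrM !pair_weight_weight.
set P := (\prod_(p < _) _)%N => scaled.
have P_gt0 : 0 < 2%:R * P%:R :> rat by rewrite mulr_gt0 ?ltr0n // prod_den_gt0.
rewrite /density ler_pdivrMr // (mulrAC _ _^-1) (mulrAC _ _^-1) ler_pdivlMr //.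
by rewrite -(ler_pM2l P_gt0); move: scaled; congr (_ <= _); ring.
Qed.

Theorem theorem3 :
  exists (alg : cmd) (p : {poly nat}),
    forall (n : nat) (G : wgraph n) (k : nat), (1 <= k <= n)%N ->
      exists (t : nat) (m : memory) (H : {set 'I_n}),
        [/\ exec alg (init_mem (encode G k)) t m,
            (t <= p.[input_size (encode G k)])%N,
            outputs m H,
            (k <= #|H|)%N
          & dal G k / 2%:R <= density G H].
Proof.
have [q qE] := cmd_weight_poly (4%:P * 'X^6 + 2%:P) algorithm.
exists algorithm, (8%:P * 'X * q) => n G k kn.
have [t [m [S [S' [run t_le out sol]]]]] := algorithm_exec kn (base_address_le_input G k)
  (pair_weight_encode_le G k) (@int_weight_sym n G k) (@prod_den_le n G k) (encode_le G k)
  (erefl n) (erefl k) (@encode_out n G k).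
exists t, m, S'; split=> //.
- by rewrite !hornerM hornerC hornerX qE hornerD hornerM !hornerC hornerXn natrXE.
- by case: sol => _ -> _; apply: leq_maxl.
- by apply: solution_density sol; case/andP: kn.
Qed.
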